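(* Let $p$ be a prime and let $G$ be a generalized Poincaré duality (GPD) pro-$p$ group of dimension $n$. Then $\operatorname{cd}(G)=n$.
   Context: Fix a prime $p$. For a pro-$p$ group $G$, $H^i(G,\mathbb{F}_p)$ denotes the $i$-th (continuous) cohomology group of $G$ with coefficients in $\mathbb{F}_p$, considered as a module with the trivial action, and $\operatorname{cd}(G)$ denotes the cohomological dimension of $G$. Generalized Poincaré duality (GPD) group of dimension $n$: an infinite pro-$p$ group $G$ (of arbitrary, possibly infinite, rank) such that $H^n(G,\mathbb{F}_p)\cong\mathbb{F}_p$ and, for every $0\leq i\leq n$, the cup product yields a nondegenerate pairing $H^i(G,\mathbb{F}_p)\times H^{n-i}(G,\mathbb{F}_p)\to H^n(G,\mathbb{F}_p)\cong\mathbb{F}_p$. Nondegeneracy means that the induced maps from each factor to the $\mathbb{F}_p$-linear dual of the other factor are injective (not necessarily isomorphisms).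
   Formalization: The dimension n is assumed positive: for n = 0 every infinite pro-p group, e.g. Z_p, satisfies the GPD definition, but no infinite pro-p group has cd(G) = 0, so the claim always fails there. *)

(* Defs.v *)
From HB Require Import structures.
From mathcomp Require Import all_boot all_order all_algebra zify.
From mathcomp Require Import all_classical topology ring.
Set Implicit Arguments.
Unset Strict Implicit.
Unset Printing Implicit Defensive.

Import GRing.Theory.
Local Open Scope classical_set_scope.
Local Open Scope quotient_scope.
Local Open Scope ring_scope.

HB.mixin Record isTopologicalGroup G of Group G & Topological G := {
  mulg_continuous : continuous (fun xy : G * G => (xy.1 * xy.2)%g);
  invg_continuous : continuous (fun x : G => x^-1%g)
}.

#[short(type="topGroupType")]
HB.structure Definition TopologicalGroup :=
  {G of Group G & Topological G & isTopologicalGroup G}.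

Definition normal_subgroup (G : groupType) (U : set G) : Prop :=
  [/\ U 1%g, forall x y, U x -> U y -> U (x * y)%g,
      forall x, U x -> U x^-1%g &
      forall x g, U x -> U (x ^ g)%g].

Definition left_cosets (G : groupType) (U : set G) : set (set G) :=
  [set (fun u => (x * u)%g) @` U | x in [set: G]].

(* A pro-p group is a profinite group all of whose open normal subgroups have
   index a power of p. *)
Definition pro_p_group (p : nat) (G : topGroupType) : Prop :=
  [/\ compact [set: G], hausdorff_space G, totally_disconnected [set: G] &
      forall U : set G, open U -> normal_subgroup U ->
        exists k : nat, (left_cosets U #= `I_(p ^ k))%card].

HB.mixin Record isDiscreteModule (G : topGroupType) A of GRing.Zmodule A := {
  act : G -> A -> A;
  act1 : forall a, act 1%g a = a;
  actM : forall g h a, act (g * h)%g a = act g (act h a);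
  actD : forall g a b, act g (a + b) = act g a + act g b;
  act_continuous : continuous
    (fun ga : G * discrete_topology A => act ga.1 ga.2 : discrete_topology A)
}.

#[short(type="discreteModType")]
HB.structure Definition DiscreteModule (G : topGroupType) :=
  {A of GRing.Zmodule A & isDiscreteModule G A}.

Definition trivial_module (G : topGroupType) (V : Type) : Type := V.

Section TrivialModule.
Variables (G : topGroupType) (V : zmodType).

HB.instance Definition _ := GRing.Zmodule.copy (trivial_module G V) V.

Let triv_act (g : G) (a : trivial_module G V) := a.

Let triv_act_continuous : continuous
  (fun ga : G * discrete_topology (trivial_module G V) =>
     triv_act ga.1 ga.2 : discrete_topology (trivial_module G V)).
Proof. by move=> ga; exact: cvg_snd. Qed.

HB.instance Definition _ := isDiscreteModule.Build G (trivial_module G V)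
  (fun=> erefl) (fun _ _ _ => erefl) (fun _ _ _ => erefl) triv_act_continuous.

End TrivialModule.

Section Cohomology.
Variables (G : topGroupType) (A : discreteModType G).

Definition continuous_cochain n (f : ('I_n -> G) -> A) : Prop :=
  continuous (f : {ptws 'I_n -> G} -> discrete_topology A).

(* For j < n, the tuple (x_0, .., x_j x_(j+1), .., x_n); for j = n, the tuple
   (x_0, .., x_(n-1)). *)
Definition face n (j : nat) (x : 'I_n.+1 -> G) : 'I_n -> G := fun k =>
  if (k < j)%N then x (widen_ord (leqnSn n) k)
  else if k == j :> nat then (x (widen_ord (leqnSn n) k) * x (lift ord0 k))%g
  else x (lift ord0 k).

(* The term j = n of the sum is (-1)^(n+1) f(x_0, .., x_(n-1)). *)
Definition coboundary n (f : ('I_n -> G) -> A) : ('I_n.+1 -> G) -> A := fun x =>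
  act (x ord0) (f (fun k => x (lift ord0 k)))
  + \sum_(j < n.+1) f (face j x) *~ (-1) ^+ j.+1.

Definition is_cocycle n : {pred ('I_n -> G) -> A} :=
  fun f => `[< continuous_cochain f /\ coboundary f = 0 >].

Lemma discrete_cvgP (T : topologicalType) (B : choiceType)
    (f : T -> discrete_topology B) :
  continuous f <-> forall x, \forall y \near x, f y = f x.
Proof.
split=> cf x.
  apply: (cf x [set b | b = f x]); exact: discrete_set1.
by apply/discrete_cvg; exact: cf.
Qed.

Lemma continuous_cochainB n (f g : ('I_n -> G) -> A) :
  continuous_cochain f -> continuous_cochain g -> continuous_cochain (f - g).
Proof.
move=> /discrete_cvgP cf /discrete_cvgP cg; apply/discrete_cvgP => x.
near=> y; change (f y - g y = f x - g x); congr (_ - _).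
  by near: y; exact: cf.
by near: y; exact: cg.
Unshelve. all: by end_near.
Qed.

Lemma continuous_cochain0 n : continuous_cochain (0 : ('I_n -> G) -> A).
Proof. by apply/discrete_cvgP => x; exact: filterE. Qed.

Lemma act_is_zmod_morphism (g : G) : zmod_morphism (act g : A -> A).
Proof.
have a0 : act g (0 : A) = 0.
  by apply: (addrI (act g (0 : A))); rewrite -actD !addr0.
move=> a b; rewrite actD; congr (_ + _).
by apply: (addrI (act g b)); rewrite -actD !subrr a0.
Qed.

Lemma coboundaryB n : {morph @coboundary n : f g / f - g}.
Proof.
move=> f g; apply/funext => x.
change (coboundary (f - g) x = coboundary f x - coboundary g x).
rewrite /coboundary [act _ _](act_is_zmod_morphism (x ord0)) opprD addrACA.
by congr (_ + _); rewrite -sumrB; apply: eq_bigr => j _; rewrite -mulrzBl.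
Qed.

Lemma is_cocycle_zmod_closed n : zmod_closed (@is_cocycle n).
Proof.
have d0 : coboundary (0 : ('I_n -> G) -> A) = 0.
  by rewrite -[X in coboundary X](subrr 0) coboundaryB subrr.
split=> [|f g /asboolP[cf df] /asboolP[cg dg]]; apply/asboolP; split=> //.
- exact: continuous_cochain0.
- exact: continuous_cochainB.
- by rewrite coboundaryB df dg subrr.
Qed.

HB.instance Definition _ n :=
  GRing.isZmodClosed.Build _ (@is_cocycle n) (is_cocycle_zmod_closed n).

Record cocycle n := Cocycle {
  cochain_of :> ('I_n -> G) -> A;
  cocycleP : cochain_of \in @is_cocycle n
}.

HB.instance Definition _ n := [isSub for @cochain_of n].
HB.instance Definition _ n := [Choice of cocycle n by <:].
HB.instance Definition _ n := [SubChoice_isSubZmodule of cocycle n by <:].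

Definition is_coboundary n : {pred cocycle n} :=
  match n with
  | 0 => fun f => `[< f = 0 >]
  | m.+1 => fun f => `[< exists2 h : ('I_m -> G) -> A,
                           continuous_cochain h & val f = coboundary h >]
  end.

Lemma is_coboundary_zmod_closed n : zmod_closed (@is_coboundary n).
Proof.
case: n => [|n]; split; rewrite /in_mem /=.
- exact/asboolP.
- by move=> f g /asboolP -> /asboolP ->; apply/asboolP; rewrite subrr.
- apply/asboolP; exists 0; first exact: continuous_cochain0.
  by rewrite -[X in coboundary X](subrr 0) coboundaryB subrr.
- move=> f g /asboolP[h ch fh] /asboolP[k ck gk]; apply/asboolP.
  exists (h - k); first exact: continuous_cochainB.
  by rewrite coboundaryB -fh -gk.
Qed.

HB.instance Definition _ n :=
  GRing.isZmodClosed.Build _ (@is_coboundary n) (is_coboundary_zmod_closed n).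

Definition cohomology n : Type := {ideal_quot @is_coboundary n}.
HB.instance Definition _ n := GRing.Zmodule.on (cohomology n).

Definition coh_class n (f : cocycle n) : cohomology n :=
  \pi_{ideal_quot @is_coboundary n} f.

Definition coh_repr n (x : cohomology n) : cocycle n :=
  repr (x : {ideal_quot @is_coboundary n}).

Lemma coh_reprK n (x : cohomology n) : coh_class (coh_repr x) = x.
Proof. exact: reprK. Qed.

Lemma coh_class_eq n (f g : cocycle n) :
  coh_class f = coh_class g <-> f - g \in @is_coboundary n.
Proof. by rewrite (Quotient.idealrBE (@is_coboundary n)); split=> /eqP. Qed.

End Cohomology.
Arguments cohomology {G} A n.

Section CupProduct.
Variables (G : topGroupType) (R : comNzRingType).
Notation M := (trivial_module G R).

(* (f u g)(x_1, .., x_(i+j)) = f(x_1, .., x_i) g(x_(i+1), .., x_(i+j)): with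
   trivial coefficients no group element acts on the second factor. The
   equation e allows any index m equal to i + j. *)
Definition cochain_cup i j m (e : (i + j)%N = m)
    (f : ('I_i -> G) -> M) (g : ('I_j -> G) -> M) : ('I_m -> G) -> M := fun x =>
  (f (fun k => x (cast_ord e (lshift j k))) : R) *
  (g (fun k => x (cast_ord e (rshift i k))) : R).

Lemma ptws_comp_continuous i m (h : 'I_i -> 'I_m) :
  continuous ((fun x => x \o h) : {ptws 'I_m -> G} -> {ptws 'I_i -> G}).
Proof.
move=> x; have FF : Filter ((fun x : {ptws 'I_m -> G} => x \o h) @ x).
  exact: (fmap_filter _ (nbhs_filter x)).
apply/cvg_sup => k.
apply: (@continuous_comp_initial {ptws 'I_i -> G} {ptws 'I_m -> G} G
  (fun y => y k) (fun x => x \o h)).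
exact: (@proj_continuous 'I_m (fun=> G) (h k)).
Qed.

Lemma continuous_cochain_cup i j m (e : (i + j)%N = m) f g :
  continuous_cochain f -> continuous_cochain g ->
  continuous_cochain (cochain_cup e f g).
Proof.
move=> cf cg; apply/discrete_cvgP => x.
have /discrete_cvgP/(_ x) nf : continuous
    ((fun x => f (fun k => x (cast_ord e (lshift j k)))) :
       {ptws 'I_m -> G} -> discrete_topology M).
  by move=> y; exact: (cvg_comp _ _ (@ptws_comp_continuous _ _ (fun k => cast_ord e (lshift j k)) y) (cf _)).
have /discrete_cvgP/(_ x) ng : continuous
    ((fun x => g (fun k => x (cast_ord e (rshift i k)))) :
       {ptws 'I_m -> G} -> discrete_topology M).
  by move=> y; exact: (cvg_comp _ _ (@ptws_comp_continuous _ _ (fun k => cast_ord e (rshift i k)) y) (cg _)).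
near=> y; rewrite /cochain_cup; congr (_ * _).
  by near: y; exact: nf.
by near: y; exact: ng.
Unshelve. all: by end_near.
Qed.


Let leibniz_sum i j (F H : nat -> R) (a b f' : R) : F i = f' ->
  a * b + (\sum_(0 <= k < i) F k * b *~ (-1) ^+ k.+1 +
           \sum_(0 <= l < j.+1) f' * H l *~ (-1) ^+ (i + l).+1) =
  (a + \sum_(k < i.+1) F k *~ (-1) ^+ k.+1) * b +
  f' * (b + \sum_(l < j.+1) H l *~ (-1) ^+ l.+1) *~ (-1) ^+ i.
Proof.
move=> Fi; have sgn (y : R) n : y *~ (-1) ^+ n = (-1) ^+ n * y.
  by rewrite -mulrzl intr_sign.
rewrite big_ord_recr /= Fi -(big_mkord xpredT (fun k => F k *~ (-1) ^+ k.+1)).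
rewrite -(big_mkord xpredT (fun k => H k *~ (-1) ^+ k.+1)) !sgn.
have -> : \sum_(0 <= k < i) F k * b *~ (-1) ^+ k.+1 =
          (\sum_(0 <= k < i) F k *~ (-1) ^+ k.+1) * b.
  by rewrite mulr_suml; apply: eq_bigr => k _; rewrite !sgn mulrA.
have -> : \sum_(0 <= l < j.+1) f' * H l *~ (-1) ^+ (i + l).+1 =
          (-1) ^+ i * (f' * \sum_(0 <= l < j.+1) H l *~ (-1) ^+ l.+1).
  rewrite !mulr_sumr; apply: eq_bigr => l _.
  by rewrite !sgn -addnS exprD; ring.
by rewrite exprS; ring.
Qed.

Let big_shift i j m (T : nat -> R) : (i + j)%N = m ->
  \sum_(i <= k < m.+1) T k = \sum_(0 <= l < j.+1) T (i + l)%N.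
Proof.
move=> <-; rewrite -{1}[i]add0n big_addn -addnS addKn.
by apply: eq_bigr => l _; rewrite addnC.
Qed.

Lemma coboundary_cup i j m (e : (i + j)%N = m)
    (e1 : (i.+1 + j)%N = m.+1) (e2 : (i + j.+1)%N = m.+1)
    (f : ('I_i -> G) -> M) (g : ('I_j -> G) -> M) (x : 'I_m.+1 -> G) :
  coboundary (cochain_cup e f g) x =
  cochain_cup e1 (coboundary f) g x +
  cochain_cup e2 f (coboundary g) x *~ (-1) ^+ i.
Proof.
have fface k : (k < i)%N -> (fun t => face k x (cast_ord e (lshift j t))) =
    face k (fun t => x (cast_ord e1 (lshift j t))).
  move=> ki; apply/funext => t; rewrite /face /=.
  case: ifP => _; first by congr x; apply: val_inj.
  by case: ifP => _; [congr (x _ * x _)%g | congr x]; apply: val_inj.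
have gface k : (k < i)%N -> (fun t => face k x (cast_ord e (rshift i t))) =
    (fun t => x (cast_ord e1 (rshift i.+1 t))).
  move=> ki; apply/funext => t; rewrite /face /=.
  rewrite ltnNge (leq_trans (ltnW ki) (leq_addr _ _)) /=.
  rewrite gtn_eqF; last exact: leq_trans ki (leq_addr _ _).
  by congr x; apply: val_inj.
have fface' l : (fun t => face (i + l) x (cast_ord e (lshift j t))) =
    (fun t => x (cast_ord e2 (lshift j.+1 t))).
  apply/funext => t; rewrite /face /=.
  rewrite (leq_trans (ltn_ord t) (leq_addr _ _)).
  by congr x; apply: val_inj.
have gface' l : (fun t => face (i + l) x (cast_ord e (rshift i t))) =
    face l (fun t => x (cast_ord e2 (rshift i t))).
  apply/funext => t; rewrite /face /= ltn_add2l eqn_add2l.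
  case: ifP => _; first by congr x; apply: val_inj.
  by case: ifP => _; [congr (x _ * x _)%g | congr x]; apply: val_inj; rewrite /= /bump /= ?addnS.
have ffacei : face i (fun t => x (cast_ord e1 (lshift j t))) =
    (fun t => x (cast_ord e2 (lshift j.+1 t))).
  apply/funext => t; rewrite /face /= ltn_ord.
  by congr x; apply: val_inj.
have f0 : (fun t => x (lift ord0 (cast_ord e (lshift j t)))) =
    (fun t => x (cast_ord e1 (lshift j (lift ord0 t)))).
  by apply/funext => t; congr x; apply: val_inj.
have g0 : (fun t => x (lift ord0 (cast_ord e (rshift i t)))) =
    (fun t => x (cast_ord e1 (rshift i.+1 t))).
  by apply/funext => t; congr x; apply: val_inj.
have g1 : (fun t => x (cast_ord e2 (rshift i (lift ord0 t)))) =
    (fun t => x (cast_ord e1 (rshift i.+1 t))).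
  apply/funext => t; congr x; apply: val_inj.
  by rewrite /= /bump /= addnS.
rewrite /coboundary /cochain_cup.
rewrite -(big_mkord xpredT (fun k => (f (fun t => face k x (cast_ord e (lshift j t))) *
   g (fun t => face k x (cast_ord e (rshift i t))) : M) *~ (-1) ^+ k.+1)).
rewrite (@big_cat_nat _ _ _ i) //=; last by lia.
rewrite (big_shift _ e).
under eq_big_nat => k /andP[_ ki] do rewrite fface // gface //.
under [X in _ + (_ + X)]eq_bigr => l _ do rewrite fface' gface'.
rewrite f0 g0 g1.
exact: (@leibniz_sum i j (fun k => f (face k _)) (fun k => g (face k _))
  _ (g _) _ (congr1 f ffacei)).
Qed.

Lemma cup_is_cocycle i j m (e : (i + j)%N = m)
    (f : cocycle M i) (g : cocycle M j) :
  cochain_cup e f g \in @is_cocycle G M m.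
Proof.
have /asboolP[cf df] := cocycleP f; have /asboolP[cg dg] := cocycleP g.
apply/asboolP; split; first exact: continuous_cochain_cup.
have e1 : (i.+1 + j)%N = m.+1 by lia.
have e2 : (i + j.+1)%N = m.+1 by lia.
apply/funext => x; rewrite (coboundary_cup e e1 e2) df dg /cochain_cup.
by rewrite [X in X + _]mul0r [X in X *~ _]mulr0 mul0rz addr0.
Qed.

Definition cocycle_cup i j m (e : (i + j)%N = m)
    (f : cocycle M i) (g : cocycle M j) : cocycle M m :=
  Cocycle (cup_is_cocycle e f g).

(* Independent of the representatives by cup_class below. *)
Definition cup i j m (e : (i + j)%N = m)
    (x : cohomology M i) (y : cohomology M j) : cohomology M m :=
  coh_class (cocycle_cup e (coh_repr x) (coh_repr y)).

Lemma coboundary_cupl i j m (e : (i + j)%N = m)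
    (f : cocycle M i) (g : cocycle M j) :
  f \in @is_coboundary G M i -> cocycle_cup e f g \in @is_coboundary G M m.
Proof.
have /asboolP[cg dg] := cocycleP g.
case: i e f => [|i] e f /asboolP.
  move=> ->; suff -> : cocycle_cup e 0 g = 0 by exact: rpred0.
  by apply: val_inj; apply/funext => x; rewrite /= /cochain_cup [LHS]mul0r.
case=> h ch fh; case: m e => [//|m] e; apply/asboolP.
have e0 : (i + j)%N = m by lia.
have e2 : (i + j.+1)%N = m.+1 by lia.
exists (cochain_cup e0 h g); first exact: continuous_cochain_cup.
apply/funext => x; rewrite (coboundary_cup e0 e e2) dg -fh /= /cochain_cup.
by rewrite [X in _ + X *~ _]mulr0 mul0rz addr0.
Qed.

Lemma coboundary_cupr i j m (e : (i + j)%N = m)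
    (f : cocycle M i) (g : cocycle M j) :
  g \in @is_coboundary G M j -> cocycle_cup e f g \in @is_coboundary G M m.
Proof.
have /asboolP[cf df] := cocycleP f.
case: j e g => [|j] e g /asboolP.
  move=> ->; suff -> : cocycle_cup e f 0 = 0 by exact: rpred0.
  by apply: val_inj; apply/funext => x; rewrite /= /cochain_cup [LHS]mulr0.
case=> h ch gh; case: m e => [|m] e; first by lia.
have e0 : (i + j)%N = m by lia.
have e1 : (i.+1 + j)%N = m.+1 by lia.
have dcup : coboundary (cochain_cup e0 f h) =
    (cochain_cup e f g : _ -> M) *~ (-1) ^+ i.
  apply/funext => x; rewrite (coboundary_cup e0 e1 e) df -gh.
  have -> : cochain_cup e1 (0 : _ -> M) h x = 0 by exact: mul0r.
  by rewrite add0r -signr_odd; case: (odd i).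
have ccup := @continuous_cochain_cup _ _ _ e0 _ _ cf ch.
apply/asboolP; move: dcup; rewrite -signr_odd; case: (odd i) => dcup.
  exists (0 - cochain_cup e0 f h).
    by apply: continuous_cochainB; [exact: continuous_cochain0 | ].
  rewrite coboundaryB dcup -[X in coboundary X](subrr 0) coboundaryB subrr.
  by rewrite sub0r mulrN1z opprK.
by exists (cochain_cup e0 f h).
Qed.

Lemma cup_class i j m (e : (i + j)%N = m)
    (f : cocycle M i) (g : cocycle M j) :
  cup e (coh_class f) (coh_class g) = coh_class (cocycle_cup e f g).
Proof.
apply/coh_class_eq; set f' := coh_repr _; set g' := coh_repr _.
have ff' : f' - f \in @is_coboundary G M i.
  by apply/coh_class_eq; rewrite coh_reprK.
have gg' : g' - g \in @is_coboundary G M j.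
  by apply/coh_class_eq; rewrite coh_reprK.
suff -> : cocycle_cup e f' g' - cocycle_cup e f g =
    cocycle_cup e (f' - f) g' + cocycle_cup e f (g' - g).
  by apply: rpredD; [exact: coboundary_cupl | exact: coboundary_cupr].
apply: val_inj; apply/funext => x /=.
change ((cochain_cup e f' g' x : R) - cochain_cup e f g x =
  (cochain_cup e (f' - f) g' x : R) + cochain_cup e f (g' - g) x).
by rewrite /cochain_cup [X in _ = X + _]mulrBl [X in _ = _ + X]mulrBr addrA subrK.
Qed.

End CupProduct.

Notation Fp_cohomology p G n := (cohomology (trivial_module G 'F_p) n).

Definition nondegenerate_pairing (U V W : Type) (b : U -> V -> W) : Prop :=
  injective b /\ injective (fun v u => b u v).

(* Additive maps between F_p-vector spaces are F_p-linear, so phi is an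
   isomorphism of vector spaces; and as the pairing is biadditive, its two
   induced maps take values in the linear duals. For n = 0 the last condition
   holds of every pro-p group. *)
Definition GPD_group (p n : nat) (G : topGroupType) : Prop :=
  [/\ pro_p_group p G, infinite_set [set: G] &
      exists2 phi : {additive Fp_cohomology p G n -> 'F_p}, bijective phi &
        forall (i : nat) (le_in : (i <= n)%N), nondegenerate_pairing
          (fun (x : Fp_cohomology p G i) (y : Fp_cohomology p G (n - i)) =>
             phi (cup (subnKC le_in) x y))].

Definition torsion_module (A : zmodType) : Prop :=
  forall a : A, exists2 k : nat, (0 < k)%N & a *+ k = 0.

Definition cd_le (G : topGroupType) (m : nat) : Prop :=
  forall A : discreteModType G, torsion_module A ->
    forall q : nat, (m < q)%N -> forall x : cohomology A q, x = 0.

(* None stands for infinite cohomological dimension. *)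
Definition cd (G : topGroupType) : option nat :=
  if pselect (exists m, `[< cd_le G m >]) is left h then Some (ex_minn h)
  else None.

(* Main.v *)
(* Let k = F_p.

   Step 1. Let S be a finite discrete G-module killed by p. A class in H^n(G, S)
   that becomes zero in H^n(G, k) under every G-homomorphism S -> k is zero. This
   goes by induction along S' < S' + <a> with S/S' = k. Such a class comes from
   some x1 in H^n(G, S'), determined up to the image of the connecting map
   delta : H^(n-1)(G, k) -> H^n(G, S'). For a homomorphism h : S' -> k one has
   h(delta v) = f_h cup v with f_h(g) = h(g a - a), and f_h = 0 means that h
   extends to S. As H^1(G, k) pairs nondegenerately with H^(n-1)(G, k), linear
   algebra over the finite group Hom_G(S', k) provides v such that x1 - delta v is
   killed by every h, and the induction hypothesis applies.

   Step 2. H^(n+1)(G, k) = 0. A class x is the image of a class y in H^n(G, C/k),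
   where C is the acyclic module of locally constant functions G -> k, and y takes
   its values in the functions on G/U for some open normal U. As G is infinite
   there is a strictly smaller open normal V, and the homomorphisms from the
   functions on G/V to k are multiples of the sum over G/V, which vanishes on
   functions on G/U since p divides [U : V]. Step 1 for the functions on G/V modulo
   k shows y = 0 there, hence x = 0.

   Step 3. H^(n+1)(G, A) = 0 for every torsion A by devissage (the part of A prime
   to p is handled by averaging), and higher degrees follow by dimension shifting.
   As H^n(G, k) is nonzero, cd(G) = n. *)
From HB Require Import structures.
From mathcomp Require Import all_boot all_algebra all_fingroup zify.
From mathcomp Require Import cyclic pgroup sylow.
From mathcomp Require Import all_classical topology ring.
Require Import Defs.
Set Implicit Arguments.
Unset Strict Implicit.
Unset Printing Implicit Defensive.

Import GRing.Theory.
Local Open Scope classical_set_scope.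
Local Open Scope ring_scope.

(** * Tuples split into a first entry and a tail *)

Definition consx (T : Type) n (h : T) (x : 'I_n -> T) : 'I_n.+1 -> T :=
  fun i => if unlift ord0 i is Some j then x j else h.

Definition tailx (T : Type) n (x : 'I_n.+1 -> T) : 'I_n -> T :=
  fun k => x (lift ord0 k).

Lemma consx0 (T : Type) n (h : T) (x : 'I_n -> T) : consx h x ord0 = h.
Proof. by rewrite /consx unlift_none. Qed.

Lemma consxS (T : Type) n (h : T) (x : 'I_n -> T) k :
  consx h x (lift ord0 k) = x k.
Proof. by rewrite /consx liftK. Qed.

Lemma consxK (T : Type) n (h : T) (x : 'I_n -> T) : tailx (consx h x) = x.
Proof. by apply/funext => k; exact: consxS. Qed.

Lemma consx_eta (T : Type) n (x : 'I_n.+1 -> T) : x = consx (x ord0) (tailx x).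
Proof.
by apply/funext => i; case: (unliftP ord0 i) => [k|] ->; rewrite ?consxS ?consx0.
Qed.

(** * Inhomogeneous cochains *)

Section Faces.
Variable G : topGroupType.

Lemma face0_cons n (h : G) (x : 'I_n.+1 -> G) :
  face 0 (consx h x) = consx (h * x ord0)%g (tailx x).
Proof.
apply/funext => k; rewrite /face ltn0.
case: (unliftP ord0 k) => [j|] ->; rewrite ?eqxx ?consxS ?consx0 //=.
by congr (_ * _)%g; rewrite -[RHS](consx0 h x); congr (consx h x _); apply: val_inj.
Qed.

Lemma faceS_cons n j (h : G) (x : 'I_n.+1 -> G) :
  face j.+1 (consx h x) = consx h (face j x).
Proof.
apply/funext => k; rewrite /face.
have w0 : widen_ord (leqnSn n.+1) ord0 = ord0 by exact: val_inj.
have wS (i : 'I_n) : widen_ord (leqnSn n.+1) (lift ord0 i) =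
    lift ord0 (widen_ord (leqnSn n) i) by exact: val_inj.
by case: (unliftP ord0 k) => [i|] ->; rewrite ?w0 ?wS ?consxS ?consx0.
Qed.

Lemma tail_faceS n j (x : 'I_n.+2 -> G) : tailx (face j.+1 x) = face j (tailx x).
Proof. by rewrite {1}[x]consx_eta faceS_cons consxK. Qed.

(** The simplicial identity. Peeling off first entries reduces it to small indices, and only the
    case [i = j = 0], where three entries are multiplied together, needs associativity. *)
Lemma face_face n i j (x : 'I_n.+2 -> G) : (i <= j)%N ->
  face i (face j.+1 x) = face j (face i x).
Proof.
elim: n i j x => [|n IH] i j x ij; first by apply/funext => -[].
case: j i ij => [|j] [|i] // ij.
- rewrite [x]consx_eta [tailx x]consx_eta.
  move: (x ord0) (tailx x ord0) (tailx (tailx x)) => a b y.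
  by rewrite !(faceS_cons, face0_cons, consx0, consxK) mulgA.
- rewrite [x]consx_eta [tailx x]consx_eta.
  move: (x ord0) (tailx x ord0) (tailx (tailx x)) => a b y.
  by rewrite !(faceS_cons, face0_cons, consx0, consxK).
- by rewrite [x]consx_eta !faceS_cons IH.
Qed.

Section Coboundary.
Variable A : discreteModType G.

Lemma act0 (g : G) : act g (0 : A) = 0.
Proof. by rewrite -[X in act g X](subrr 0) act_is_zmod_morphism subrr. Qed.

Lemma actB (g : G) (a b : A) : act g (a - b) = act g a - act g b.
Proof. exact: act_is_zmod_morphism. Qed.

Lemma actN (g : G) (a : A) : act g (- a) = - act g a.
Proof. by rewrite -[- a]sub0r actB act0 sub0r. Qed.

Lemma act_sum (I : Type) (r : seq I) (P : pred I) (F : I -> A) (g : G) :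
  act g (\sum_(i <- r | P i) F i) = \sum_(i <- r | P i) act g (F i).
Proof. by elim/big_rec2: _ => [|i y1 y2 _ <-]; rewrite ?act0 ?actD. Qed.

Lemma actMn (g : G) (a : A) n : act g (a *+ n) = act g a *+ n.
Proof. by elim: n => [|n IH]; rewrite ?act0 // !mulrS actD IH. Qed.

Lemma actMz (g : G) (a : A) (z : int) : act g (a *~ z) = act g a *~ z.
Proof.
by case: z => n; [exact: actMn|rewrite !NegzE !mulrNz actN; congr (- _); exact: actMn].
Qed.

Lemma actK (g : G) (a : A) : act g^-1%g (act g a) = a.
Proof. by rewrite -actM mulVg act1. Qed.

(** The face that merges [h] with the first entry of [x] is isolated. The remaining terms keep [h]
    as a parameter, which is the form used for dimension shifting and averaging. *)
Lemma coboundary_cons n (f : ('I_n.+1 -> G) -> A) (h : G) (x : 'I_n.+1 -> G) :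
  coboundary f (consx h x) =
  act h (f x) - (f (consx (h * x ord0)%g (tailx x)) +
                 \sum_(j < n.+1) f (consx h (face j x)) *~ (-1) ^+ j.+1).
Proof.
rewrite /coboundary consx0 -/(tailx _) consxK; congr (_ + _).
rewrite big_ord_recl /= face0_cons expr1 mulrN1z opprD; congr (_ + _).
rewrite -sumrN; apply: eq_bigr => j _.
by rewrite /= /bump /= add1n faceS_cons exprS mulN1r mulrNz.
Qed.

(** The action term counts as coface [0] and [face j] gives coface [j.+1], so that the differential
    is a plain alternating sum. *)
Definition coface n (i : nat) (f : ('I_n -> G) -> A) : ('I_n.+1 -> G) -> A :=
  fun x => if i is j.+1 then f (face j x) else act (x ord0) (f (tailx x)).

Lemma coboundaryE n (f : ('I_n -> G) -> A) x :
  coboundary f x = \sum_(i < n.+2) coface i f x *~ (-1) ^+ i.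
Proof. by rewrite big_ord_recl. Qed.

Lemma coface_coface n i j (f : ('I_n -> G) -> A) x : (i <= j)%N ->
  coface j.+1 (coface i f) x = coface i (coface j f) x.
Proof.
case: i j => [|i] [|j] //= ij; last by rewrite face_face.
- rewrite -actM; congr (act _ (f _)).
  by rewrite [x]consx_eta face0_cons !consx0 consxK.
- rewrite tail_faceS; congr (act _ _).
  by rewrite [x]consx_eta faceS_cons !consx0.
Qed.

Lemma coboundaryK n (f : ('I_n -> G) -> A) : coboundary (coboundary f) = 0.
Proof.
apply/funext => x; change (coboundary (coboundary f) x = 0).
pose E i j := coface i (coface j f) x *~ ((-1) ^+ i * (-1) ^+ j).
have -> : coboundary (coboundary f) x =
    \sum_(i < n.+3) \sum_(j < n.+2) E i j.
  rewrite coboundaryE; apply: eq_bigr => -[[|i] ilt] _ /=.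
    rewrite coboundaryE act_sum expr0 mulr1z; apply: eq_bigr => j _.
    by rewrite /E /= actMz expr0 mul1r.
  rewrite coboundaryE mulrz_suml; apply: eq_bigr => j _.
  by rewrite /E -mulrzA mulrC.
rewrite pair_bigA /= (bigID (fun p : 'I_n.+3 * 'I_n.+2 => (p.1 <= p.2)%N)) /=.
apply/eqP; rewrite addrC addr_eq0 -sumrN.
(* The pairs with [i <= j] are matched with the others by [(i, j) |-> (j + 1, i)], with inverse
   [(i, j) |-> (j, i - 1)]. The matched terms agree by [coface_coface] and have opposite signs. *)
rewrite (reindex_onto (fun p : 'I_n.+3 * 'I_n.+2 =>
     (lift ord0 p.2, inord p.1) : 'I_n.+3 * 'I_n.+2)
   (fun p => (widen_ord (leqnSn _) p.2, inord p.1.-1))) /=; last first.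
  move=> [[i ilt] [j jlt]] /=; rewrite -ltnNge => ji.
  congr (_, _); apply: val_inj; rewrite /= ?inordK //=; last by lia.
  by rewrite /bump /= add1n prednK //; lia.
apply/eqP; apply: eq_big => [[[i ilt] [j jlt]]|[[i ilt] [j jlt]]] /=.
  rewrite /bump /= add1n -ltnNge ltnS; case: (leqP i j) => ij.
    rewrite inordK; last by lia.
    rewrite ij /=; apply/eqP; congr (_, _); apply: val_inj => /=; rewrite ?inordK //; lia.
  apply/negbTE; apply/negP => /andP[+ /eqP[]]; lia.
rewrite /bump /= add1n => /andP[h1 /eqP[h2 h3]].
have il : (i < n.+2)%N by rewrite -h2.
rewrite inordK // in h1 *; rewrite /E coface_coface //; last by lia.
by rewrite -mulrNz; congr (_ *~ _); rewrite exprS; ring.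
Qed.

End Coboundary.
End Faces.

(** * Locally constant functions on compact groups *)

(** This is continuity into the discrete topology, but [B] may be any type, in particular a type of
    functions or [Prop]. *)
Definition locally_constant (T : topologicalType) (B : Type) (f : T -> B) : Prop :=
  forall x, \forall y \near x, f y = f x.

Lemma locally_constant_comp (S T : topologicalType) B (g : S -> T) (f : T -> B) :
  continuous g -> locally_constant f -> locally_constant (f \o g).
Proof. by move=> cg lf x; apply: cg (lf (g x)). Qed.

Lemma locally_constant_map (T : topologicalType) B C (h : B -> C) (f : T -> B) :
  locally_constant f -> locally_constant (h \o f).
Proof. by move=> lf x; apply: filterS (lf x) => y /= ->. Qed.

Lemma locally_constant_map2 (T : topologicalType) A B C (h : A -> B -> C)
    (f : T -> A) (g : T -> B) :
  locally_constant f -> locally_constant g -> locally_constant (fun x => h (f x) (g x)).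
Proof.
move=> lf lg x; have := lg x; have := lf x.
by apply: filterS2 => y -> ->.
Qed.

Lemma locally_constant_cst (T : topologicalType) B (b : B) :
  locally_constant (fun _ : T => b).
Proof. by move=> x; exact: nearW. Qed.

(** The tube lemma: by compactness the neighbourhoods of [t] found around the various points of [K]
    can be replaced by a single one. *)
Lemma locally_constant_tube (K T : topologicalType) B (f : K -> T -> B) :
  compact [set: K] -> locally_constant (fun kt : K * T => f kt.1 kt.2) ->
  locally_constant (fun t k => f k t).
Proof.
move=> /compact_near_coveringP cK lf t.
have near_eq k : [set: K] k -> \forall k' \near k & t' \near t, f k' t' = f k' t.
  move=> _; have [[U V] /= [Uk Vt] UV] := lf (k, t).
  exists (U, V) => //= -[k' t'] [/= Uk' Vt'].
  rewrite (UV (k', t')) // -(UV (k', t)) //; split=> //=; exact: nbhs_singleton.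
have := cK T (nbhs t) (fun t' k => f k t' = f k t) (nbhs_filter t) near_eq.
by apply: filterS => t' tt'; apply/funext => k; exact: tt'.
Qed.

Lemma finite_range_locally_constant (K : topologicalType) (B : choiceType)
    (f : K -> B) :
  compact [set: K] -> locally_constant f -> finite_set (range f).
Proof.
move=> /compact_near_coveringP cK lf.
(* Along the filter of finite sets ordered by inclusion, each value of [f] eventually lies in [D].
   Compactness then yields one finite [D] that contains all values. *)
pose above (D0 : set B) := [set D | finite_set D /\ D0 `<=` D].
have FF : Filter (filter_from [set D | finite_set D] above).
  apply: filter_from_filter; first by exists set0; exact: finite_set0.
  move=> D D' fD fD'; exists (D `|` D'); first by rewrite /= finite_setU.
  move=> E [fE sE]; split; split=> // b bD; apply: sE; [by left|by right].
have [x _|D fD DP] := cK _ _ (fun D x => D (f x)) FF.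
  exists ([set y | f y = f x], above [set f x]) => /=.
    split; first exact: lf.
    by exists [set f x] => //; exact: finite_set1.
  by move=> [y D] /= [-> [_ fxD]]; exact: fxD.
apply: (sub_finite_set _ fD) => _ [x _ <-].
by have := DP D (conj fD (fun _ => id)) x I.
Qed.

Lemma open_locally_constant (T : topologicalType) B (f : T -> B) (P : set B) :
  locally_constant f -> open (f @^-1` P).
Proof.
move=> lf; rewrite openE => x Px; rewrite /interior.
by apply: filterS (lf x) => y /= ->.
Qed.

Lemma locally_constant_clopen (T : topologicalType) (A : set T) :
  clopen A -> locally_constant (A : T -> Prop).
Proof.
move=> [oA cA] x; have [Ax|nAx] := pselect (A x).
  by apply: filterS (open_nbhs_nbhs (conj oA Ax)) => y Ay; apply/propext.
have oC : open_nbhs x (~` A) by split=> //; exact: closed_openC.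
by apply: filterS (open_nbhs_nbhs oC) => y nAy; apply/propext.
Qed.

Lemma continuous_compose (S T U : topologicalType) (f : S -> T) (g : T -> U) :
  continuous f -> continuous g -> continuous (g \o f).
Proof. by move=> cf cg x; exact: (cvg_comp _ _ (cf x) (cg (f x))). Qed.

Lemma continuous_const (S T : topologicalType) (t : T) : continuous (fun _ : S => t).
Proof. by move=> x; exact: cvg_cst. Qed.

Lemma continuous_idfun (T : topologicalType) : continuous (fun x : T => x).
Proof. by move=> x; exact: cvg_id. Qed.

Lemma continuous_fst (S T : topologicalType) : continuous (@fst S T).
Proof. by move=> x; exact: cvg_fst. Qed.

Lemma continuous_snd (S T : topologicalType) : continuous (@snd S T).
Proof. by move=> x; exact: cvg_snd. Qed.

Lemma continuous_pair (S T U : topologicalType) (f : S -> T) (g : S -> U) :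
  continuous f -> continuous g -> continuous (fun x => (f x, g x)).
Proof. by move=> cf cg x; apply: cvg_pair; [exact: cf|exact: cg]. Qed.

Section Group.
Variable G : topGroupType.

Lemma ptws_continuous (T : topologicalType) n (F : T -> {ptws 'I_n -> G}) :
  (forall k, continuous (fun t => F t k)) -> continuous F.
Proof.
move=> cF x; have FF : Filter (F @ x) by exact: (fmap_filter _ (nbhs_filter x)).
apply/cvg_sup => k.
exact: (@continuous_comp_initial {ptws 'I_n -> G} T G (fun y => y k) F (cF k)).
Qed.

Lemma coord_continuous n (k : 'I_n) : continuous (fun x : {ptws 'I_n -> G} => x k).
Proof. exact: (@proj_continuous 'I_n (fun=> G) k). Qed.

Lemma mul_continuous (T : topologicalType) (f g : T -> G) :
  continuous f -> continuous g -> continuous (fun x => (f x * g x)%g).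
Proof.
move=> cf cg x.
exact: (continuous2_cvg _ (mulg_continuous (f x, g x)) (cf x) (cg x)).
Qed.

Lemma tailx_continuous n :
  continuous (@tailx G n : {ptws 'I_n.+1 -> G} -> {ptws 'I_n -> G}).
Proof. by apply: ptws_continuous => k; exact: coord_continuous. Qed.

Lemma consx_continuous n : continuous
  (fun hx : G * {ptws 'I_n -> G} => consx hx.1 hx.2 : {ptws 'I_n.+1 -> G}).
Proof.
apply: ptws_continuous => k; rewrite /consx; case: (unlift ord0 k) => [j|].
  apply: (continuous_compose (f := snd) (g := fun x : {ptws 'I_n -> G} => x j)).
    exact: continuous_snd.
  exact: coord_continuous.
exact: continuous_fst.
Qed.

Lemma face_continuous n j :
  continuous (@face G n j : {ptws 'I_n.+1 -> G} -> {ptws 'I_n -> G}).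
Proof.
apply: ptws_continuous => k; rewrite /face.
case: (k < j)%N; first exact: coord_continuous.
case: (k == j :> nat); last exact: coord_continuous.
by apply: mul_continuous; exact: coord_continuous.
Qed.

Lemma ptws_compact n : compact [set: G] -> compact [set: {ptws 'I_n -> G}].
Proof.
move=> cG; have tG := @tychonoff 'I_n (fun=> G) (fun=> setT) (fun=> cG).
have <- : [set f : 'I_n -> G | 'I_n -> True] = setT by apply/seteqP.
exact: tG.
Qed.

(* The largest normal subgroup under which all [f k] are invariant. *)
Definition invariance (K B : Type) (f : K -> G -> B) : set G :=
  [set u | forall k a b, f k (a * u * b)%g = f k (a * b)%g].

(** By the tube lemma over [K * (G * G)], the function [(k, (a, b)) |-> f k (a * u * b)] depends
    locally constantly on [u], and the invariance group is the set of [u] where it is the same as at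
    [1]. Factors on both sides give normality. *)
Lemma open_normal_invariance (K : topologicalType) B (f : K -> G -> B) :
  compact [set: G] -> compact [set: K] ->
  locally_constant (fun kg : K * G => f kg.1 kg.2) ->
  open (invariance f) /\ normal_subgroup (invariance f).
Proof.
move=> cG cK lf.
have lc : locally_constant (fun (u : G) (kab : K * (G * G)) =>
    f kab.1 (kab.2.1 * u * kab.2.2)%g).
  apply: (locally_constant_tube (f := fun kab u => f kab.1 (kab.2.1 * u * kab.2.2)%g)).
    rewrite -setXTT; apply: compact_setX => //.
    by rewrite -setXTT; apply: compact_setX.
  apply: (locally_constant_comp
     (g := fun x : (K * (G * G)) * G => (x.1.1, (x.1.2.1 * x.2 * x.1.2.2)%g)) _ lf).
  have [f1 s1] : continuous (@fst (K * (G * G)) G) /\ continuous (@snd (K * (G * G)) G).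
    by split; [exact: continuous_fst|exact: continuous_snd].
  have f2 := continuous_compose f1 (@continuous_fst _ _).
  have s2 := continuous_compose f1 (@continuous_snd _ _).
  have a2 := continuous_compose s2 (@continuous_fst _ _).
  have b2 := continuous_compose s2 (@continuous_snd _ _).
  apply: continuous_pair; first exact: f2.
  by apply: mul_continuous => //; apply: mul_continuous.
split.
  pose P : set (K * (G * G) -> B) :=
    [set h | forall k a b, h (k, (a, b)) = f k (a * b)%g].
  exact: (open_locally_constant P lc).
split=> [k a b|x y Ux Uy k a b|x Ux k a b|x g Ux k a b].
- by rewrite mulg1.
- by rewrite mulgA Uy Ux.
- by rewrite -(Ux k (a * x^-1)%g) mulgVK.
- by rewrite conjgE !mulgA -(mulgA _ g b) Ux mulgA mulgVK.
Qed.

Lemma open_subgroup_closed (U : set G) : open U -> normal_subgroup U -> closed U.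
Proof.
move=> oU [U1 UM UV _].
rewrite -[U]setCK; apply: open_closedC; rewrite openE => x nUx; rewrite /interior.
have cx : continuous (fun y : G => x^-1 * y)%g.
  by apply: mul_continuous => y; [exact: cvg_cst|exact: cvg_id].
have : nbhs x ((fun y => x^-1 * y)%g @^-1` U).
  by apply: cx; rewrite mulVg; apply: open_nbhs_nbhs.
apply: filterS => y /= Uxy Uy; apply: nUx.
have := UM _ _ Uy (UV _ Uxy).
by rewrite invMg invgK mulgA mulgV mul1g.
Qed.

Lemma open_normal_shrink p (U : set G) :
  pro_p_group p G -> infinite_set [set: G] -> open U -> normal_subgroup U ->
  exists V, [/\ open V, normal_subgroup V, V `<=` U & exists2 u, U u & ~ V u].
Proof.
move=> [cG hG tdG pG] infG oU nU; have [U1 UM UV UJ] := nU.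
apply: contrapT => minU; apply: infG.
(* If [U] is minimal then it is connected: a clopen [B] inside [U] is invariant
   under an open normal subgroup, hence under [U]. So [U] is trivial. *)
have conU : connected U.
  move=> B [x Bx] [C oC BC] [D cD BD].
  have clB : clopen B.
    split; first by rewrite BC; exact: openI.
    by rewrite BD; apply: closedI => //; exact: open_subgroup_closed.
  have lcB : locally_constant (fun kg : G * G => B kg.2).
    apply: (locally_constant_comp (g := snd)); first exact: continuous_snd.
    exact: locally_constant_clopen.
  have [oV nV] := open_normal_invariance (f := fun _ : G => B) cG cG lcB.
  set V := invariance _ in oV nV.
  have UsubV : U `<=` V.
    apply: contrapT => /existsNP[u /not_implyP[Uu nVu]]; apply: minU.
    exists (U `&` V); split=> //; last by exists u => // -[].
      exact: openI.
    have [V1 VM VV VJ] := nV.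
    split=> //= [a b [? ?] [? ?]|a [? ?]|a g [? ?]]; split; auto.
  apply/seteqP; split=> [y|y Uy]; first by rewrite BC => -[].
  have Ux : U x by move: Bx; rewrite BC => -[].
  have := UsubV _ (UM _ _ (UV _ Ux) Uy) x x 1%g.
  by rewrite !mulg1 mulKVg => ->.
have U1E : U = [set 1%g].
  apply/seteqP; split=> [u Uu|_ ->] //.
  have <- := tdG 1%g I; by exists U.
(* The cosets of the trivial group are the points of [G], so finite index makes [G] finite. *)
have [k cU] := pG _ oU nU.
have : finite_set (left_cosets U) by apply/finite_setP; exists (p ^ k)%N.
rewrite /left_cosets (eq_finite_set (inj_card_eq _)) // => x y _ _ /= xy.
have : [set (x * u)%g | u in U] x by exists 1%g => //; rewrite mulg1.
by rewrite xy U1E => -[_ ->]; rewrite mulg1.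
Qed.
End Group.

(** * Submodules and composition series *)

Lemma locally_constant_sum (T : topologicalType) (A : zmodType) I (r : seq I)
    (F : I -> T -> A) : (forall i, locally_constant (F i)) ->
  locally_constant (fun y => \sum_(i <- r) F i y).
Proof.
move=> lF; elim: r => [|i r IH] x.
  by apply: filterE => y; rewrite !big_nil.
by apply: filterS2 (lF i x) (IH x) => y; rewrite !big_cons => -> ->.
Qed.

Section Submodules.
Variables (G : topGroupType) (A : discreteModType G).
Implicit Types S : set A.

(** Submodules are sets inside a fixed module, so that one cochain can be viewed in several of them
    without changing its type. *)
Definition submodule S : Prop :=
  [/\ S 0, forall a b, S a -> S b -> S (a - b) &
      forall g a, S a -> S (act g a)].

Lemma submoduleN S a : submodule S -> S a -> S (- a).
Proof. by move=> [S0 SB _] Sa; rewrite -sub0r; exact: SB. Qed.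

Lemma submoduleD S a b : submodule S -> S a -> S b -> S (a + b).
Proof.
move=> sS Sa Sb; rewrite -[b]opprK.
by have [_ SB _] := sS; apply: SB => //; exact: submoduleN.
Qed.

Lemma submoduleMn S a n : submodule S -> S a -> S (a *+ n).
Proof.
move=> sS Sa; elim: n => [|n IH]; first by rewrite mulr0n; case: sS.
by rewrite mulrS; exact: submoduleD.
Qed.

Lemma submoduleMz S a z : submodule S -> S a -> S (a *~ z).
Proof.
move=> sS Sa; case: z => n; first exact: submoduleMn.
by rewrite NegzE mulrNz; apply: submoduleN => //; exact: submoduleMn.
Qed.

Lemma submodule_sum S (I : Type) (r : seq I) (P : pred I) (F : I -> A) :
  submodule S -> (forall i, P i -> S (F i)) -> S (\sum_(i <- r | P i) F i).
Proof.
move=> sS SF; elim/big_ind: _ => //; first by case: sS.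
by move=> a b; exact: submoduleD.
Qed.

Lemma submodule0 : submodule [set 0].
Proof. by split=> // [a b -> ->|g a ->]; rewrite ?subrr ?act0. Qed.

Lemma submoduleT : submodule [set: A].
Proof. by []. Qed.

Section Hom.
Variables (B : discreteModType G) (S : set A) (h : A -> B).
Hypothesis sS : submodule S.

(** A homomorphism from [S] is encoded as a total map; its values outside [S] are arbitrary. *)
Definition hom_on : Prop :=
  (forall a b, S a -> S b -> h (a - b) = h a - h b) /\
  (forall g a, S a -> h (act g a) = act g (h a)).

Hypothesis hh : hom_on.

Lemma hom_on0 : h 0 = 0.
Proof. by case: sS => S0 _ _; rewrite -(subrr 0) hh.1 // subrr. Qed.

Lemma hom_onN a : S a -> h (- a) = - h a.
Proof. by case: sS => S0 _ _ Sa; rewrite -sub0r hh.1 // hom_on0 sub0r. Qed.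

Lemma hom_onD a b : S a -> S b -> h (a + b) = h a + h b.
Proof.
move=> Sa Sb; rewrite -{1}[b]opprK hh.1 ?hom_onN ?opprK //.
exact: submoduleN.
Qed.

Lemma hom_onMn a n : S a -> h (a *+ n) = h a *+ n.
Proof.
move=> Sa; elim: n => [|n IH]; first by rewrite !mulr0n hom_on0.
by rewrite !mulrS hom_onD ?IH //; exact: submoduleMn.
Qed.

Lemma hom_onMz a z : S a -> h (a *~ z) = h a *~ z.
Proof.
move=> Sa; case: z => n; first exact: hom_onMn.
by rewrite NegzE !mulrNz hom_onN ?(hom_onMn n.+1) //; exact: (submoduleMn n.+1).
Qed.

Lemma hom_on_sum (I : Type) (r : seq I) (P : pred I) (F : I -> A) :
  (forall i, P i -> S (F i)) ->
  h (\sum_(i <- r | P i) F i) = \sum_(i <- r | P i) h (F i).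
Proof.
move=> SF; elim: r => [|i r IH]; first by rewrite !big_nil hom_on0.
rewrite !big_cons; case: ifP => // Pi.
by rewrite hom_onD ?IH //; [exact: SF|exact: submodule_sum].
Qed.

Lemma coboundary_hom n (f : ('I_n -> G) -> A) x : (forall y, S (f y)) ->
  coboundary (h \o f) x = h (coboundary f x).
Proof.
move=> Sf; have [_ _ Sg] := sS.
have Sc i : S (coface i f x) by case: i => [|i] /=; [exact: Sg|exact: Sf].
rewrite !coboundaryE hom_on_sum => [|i _]; last exact: submoduleMz.
apply: eq_bigr => -[[|i] ilt] _ /=; rewrite hom_onMz ?hh.2 //; exact: Sg.
Qed.
End Hom.

Lemma coboundary_in n (f : ('I_n -> G) -> A) S : submodule S ->
  (forall y, S (f y)) -> forall x, S (coboundary f x).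
Proof.
move=> sS Sf x; have [_ _ Sg] := sS.
rewrite coboundaryE; apply: submodule_sum => // i _; apply: submoduleMz => //.
by case: (i : nat) => [|j] /=; [exact: Sg|exact: Sf].
Qed.

Lemma continuous_cochainP n (f : ('I_n -> G) -> A) : continuous_cochain f <->
  locally_constant (f : {ptws 'I_n -> G} -> A).
Proof. exact: discrete_cvgP. Qed.

Lemma act_locally_constant :
  locally_constant (fun ga : G * discrete_topology A => act ga.1 ga.2).
Proof. by apply/discrete_cvgP; exact: act_continuous. Qed.

Lemma locally_constant_act (T : topologicalType) (g : T -> G) (f : T -> A) :
  continuous g -> locally_constant f -> locally_constant (fun x => act (g x) (f x)).
Proof.
move=> cg lf.
have cf : continuous (f : T -> discrete_topology A) by apply/discrete_cvgP.
exact: (locally_constant_comp (continuous_pair cg cf) act_locally_constant).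
Qed.

Lemma continuous_coboundary n (f : ('I_n -> G) -> A) :
  continuous_cochain f -> continuous_cochain (coboundary f).
Proof.
move=> /continuous_cochainP lf; apply/continuous_cochainP.
apply: (@locally_constant_map2 _ _ _ _ +%R
  (fun y : {ptws 'I_n.+1 -> G} => act (y ord0) (f (tailx y)))
  (fun y => \sum_(j < n.+1) f (face j y) *~ (-1) ^+ j.+1)).
  apply: locally_constant_act; first exact: coord_continuous.
  exact: (locally_constant_comp (@tailx_continuous _ _) lf).
apply: locally_constant_sum => j.
apply: (locally_constant_map (fun a => a *~ (-1) ^+ j.+1)).
exact: (locally_constant_comp (@face_continuous _ _ j) lf).
Qed.

Lemma continuous_cochainD n (f g : ('I_n -> G) -> A) :
  continuous_cochain f -> continuous_cochain g -> continuous_cochain (f + g).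
Proof.
move=> /continuous_cochainP cf /continuous_cochainP cg; apply/continuous_cochainP.
exact: (locally_constant_map2 +%R).
Qed.

Lemma coboundaryD n : {morph @coboundary G A n : f g / f + g}.
Proof.
move=> f g; have d0 : coboundary (0 : ('I_n -> G) -> A) = 0.
  by rewrite -[X in coboundary X](subrr 0) coboundaryB subrr.
by rewrite -{1}[g]opprK -[- g]sub0r !coboundaryB d0 sub0r opprK.
Qed.

(** For a cocycle [f] with values in [S] this is the vanishing of its class in the cohomology of [S]
    itself, since the primitive must stay in [S]. *)
Definition trivial_in S n (f : ('I_n.+1 -> G) -> A) : Prop :=
  exists z : ('I_n -> G) -> A,
    [/\ continuous_cochain z, forall x, S (z x) & coboundary z = f].

Lemma trivial_inD S n (f g : ('I_n.+1 -> G) -> A) : submodule S ->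
  trivial_in S f -> trivial_in S g -> trivial_in S (f + g).
Proof.
move=> sS [y [cy Sy <-]] [z [cz Sz <-]]; exists (y + z); split.
- exact: continuous_cochainD.
- by move=> x; apply: submoduleD.
- exact: coboundaryD.
Qed.

Lemma trivial_inB S n (f g : ('I_n.+1 -> G) -> A) : submodule S ->
  trivial_in S f -> trivial_in S g -> trivial_in S (f - g).
Proof.
move=> sS [y [cy Sy <-]] [z [cz Sz <-]]; exists (y - z); split.
- exact: continuous_cochainB.
- by move=> x; have [_ SB _] := sS; exact: SB.
- exact: coboundaryB.
Qed.

Lemma trivial_in0 S n : submodule S -> trivial_in S (0 : ('I_n.+1 -> G) -> A).
Proof.
move=> [S0 _ _]; exists 0; split=> //; first exact: continuous_cochain0.
by rewrite -[X in coboundary X](subrr 0) coboundaryB subrr.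
Qed.

Lemma trivial_inMn S n (f : ('I_n.+1 -> G) -> A) i : submodule S ->
  trivial_in S f -> trivial_in S (f *+ i).
Proof.
move=> sS tf; elim: i => [|i IH]; first exact: trivial_in0.
by rewrite mulrS; exact: trivial_inD.
Qed.

Lemma trivial_inW S S' n (f : ('I_n.+1 -> G) -> A) : S `<=` S' ->
  trivial_in S f -> trivial_in S' f.
Proof. by move=> SS' [z [cz Sz dz]]; exists z; split=> // x; exact/SS'. Qed.

End Submodules.

Lemma continuous_cochain_map (G : topGroupType) (A B : discreteModType G)
    (h : A -> B) n (f : ('I_n -> G) -> A) :
  continuous_cochain f -> continuous_cochain (h \o f).
Proof.
move=> /continuous_cochainP cf; apply/continuous_cochainP.
exact: locally_constant_map.
Qed.

(** Turns the set of fibres of [f] on [S] into a [finType], with projection [q] and section [s], so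
    that counting arguments for finite types apply to cosets. *)
Lemma finite_quotient (X Y : Type) (S : set X) (f : X -> Y) :
  S !=set0 -> finite_set (f @` S) ->
  exists (T : finType) (q : X -> T) (s : T -> X),
    [/\ (f @` S #= `I_#|T|)%card, forall t, S (s t), forall t, q (s t) = t &
        forall x y, S x -> S y -> q x = q y <-> f x = f y].
Proof.
move=> [x0 Sx0] /finite_setP[n /[dup] cfS /card_set_bijP[g [gI ginj gsurj]]].
have {}gI x : S x -> (g (f x) < n)%N by move=> Sx; apply: gI; exists x.
case: n => [|n] in cfS gI gsurj; first by have := gI _ Sx0.
have {}gsurj (t : 'I_n.+1) : exists x, S x /\ inord (g (f x)) = t.
  have [_ [x Sx <-] gx] := gsurj t (ltn_ord t).
  by exists x; split=> //; rewrite gx inord_val.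
have [s sP] := choice gsurj.
exists 'I_n.+1, (fun x => inord (g (f x))), s; split=> [|t|t|x y Sx Sy].
- by rewrite card_ord.
- exact: (sP t).1.
- exact: (sP t).2.
split=> [/(congr1 val)|->] //=; rewrite !inordK ?gI // => gxy.
by apply: ginj => //; apply/mem_set; [exists x|exists y].
Qed.

(** * Pro-p groups acting on finite sets *)

Section FiniteAction.
Variables (p : nat) (G : topGroupType) (T : finType) (a : G -> T -> T).
Hypotheses (p_pr : prime p) (Gp : pro_p_group p G).
Hypothesis a1 : forall t, a 1%g t = t.
Hypothesis aM : forall g h t, a (g * h)%g t = a g (a h t).
Hypothesis a_lc : forall t, locally_constant (a^~ t).

Let aK g : cancel (a g) (a g^-1%g).
Proof. by move=> t; rewrite -aM mulVg a1. Qed.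

Let pm g : {perm T} := perm (can_inj (aK g)).

(** The order is reversed because permutations are composed from left to right. *)
Let pmM g h : pm (g * h)%g = (pm h * pm g)%g.
Proof. by apply/permP => t; rewrite permM !permE aM. Qed.

Let pm1 : pm 1%g = 1%g.
Proof. by apply/permP => t; rewrite perm1 permE a1. Qed.

Let H : {set {perm T}} := [set s | `[<exists g, s = pm g>]].

Let HP s : reflect (exists g, s = pm g) (s \in H).
Proof. by rewrite finset.in_set; exact: asboolP. Qed.

Let pmH g : pm g \in H.
Proof. by apply/HP; exists g. Qed.

Let group_set_H : group_set H.
Proof.
apply/group_setP; split; first by rewrite -pm1.
by move=> s t /HP[g ->] /HP[h ->]; rewrite -pmM.
Qed.

Let HG : {group {perm T}} := group group_set_H.

(** The kernel [N] of the action is open, because finitely many locally constant maps are constant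
    on a common neighbourhood. The image [H] is in bijection with the cosets of [N], whose number is
    a power of p. *)
Let card_H : exists k, #|H| = (p ^ k)%N.
Proof.
pose N := [set g | pm g = 1%g].
have pm_lc : locally_constant pm.
  move=> g; have : \forall h \near g, forall t, a h t = a g t.
    by apply: filter_forall => t; exact: a_lc.
  by apply: filterS => h gh; apply/permP => t; rewrite !permE.
have oN : open N := open_locally_constant [set 1%g] pm_lc.
have pmV g : pm g^-1%g = (pm g)^-1%g.
  by apply: (mulIg (pm g)); rewrite -pmM mulgV pm1 mulVg.
have nN : normal_subgroup N.
  split=> [|x y|x|x g]; rewrite /N /= ?pm1 //.
  - by rewrite pmM => -> ->; rewrite mulg1.
  - by rewrite pmV => ->; rewrite invg1.
  - by rewrite conjgE !pmM pmV => ->; rewrite mulg1 mulgV.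
have [_ _ _ /(_ N oN nN)[k cN]] := Gp; exists k.
have [f [fI finj fsurj]] := card_set_bijP cN.
pose coset g := [set (g * u)%g | u in N].
have cosetP g h : coset g = coset h <-> pm g = pm h.
  split=> [gh|gh].
    have : coset g g by exists 1%g; rewrite ?mulg1 // /N /= pm1.
    by rewrite gh => -[u + <-]; rewrite pmM /N /= => ->; rewrite mul1g.
  have sub x y : pm x = pm y -> coset x `<=` coset y.
    move=> xy _ [u Nu <-]; exists (y^-1 * (x * u))%g; last by rewrite mulKVg.
    by rewrite /N /= !pmM pmV Nu xy mul1g mulgV.
  by apply/seteqP; split; apply: sub.
have cosetL g : left_cosets N (coset g) by exists g.
have rep s : exists g, s \in H -> s = pm g.
  by have [[g ->]|_] := HP s; [exists g|exists 1%g].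
have [r rP] := choice rep.
have pk_gt0 : (0 < p ^ k)%N by rewrite expn_gt0 prime_gt0.
pose F s : 'I_(p ^ k) := insubd (Ordinal pk_gt0) (f (coset (r s))).
have FE s : val (F s) = f (coset (r s)).
  by rewrite val_insubd (fI _ (cosetL _)).
rewrite -(card_ord (p ^ k)) -cardsT.
have <- : (F @: H = finset.setTfor 'I_(p ^ k))%SET.
  apply/setP => i; rewrite finset.in_setT; apply/imsetP.
  have [_ [g _ <-] fi] := fsurj i (ltn_ord i).
  exists (pm g) => //; apply: val_inj; rewrite FE /= -fi.
  by congr f; apply/cosetP; rewrite -(rP (pm g)).
rewrite card_in_imset // => s t sH tH /(congr1 val); rewrite !FE => /finj.
rewrite !inE => /(_ (cosetL _) (cosetL _))/cosetP.
by rewrite -!rP.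
Qed.

Lemma card_fixed_points :
  #|T| = #|[set t | `[<forall g, a g t = t>]]%SET| %[mod p].
Proof.
have [k cH] := card_H.
have pH : (p.-group HG)%g by rewrite /pgroup cH pnatX pnat_id.
have aH : [acts HG, on finset.setTfor T | perm_action T]%act.
  by apply/actsP => s _ t; rewrite !finset.in_setT.
have := pgroup_fix_mod pH aH; rewrite cardsT => ->.
congr (_ %% _)%N; apply: eq_card => t.
rewrite finset.in_setI finset.in_setT [RHS]finset.in_set andTb.
apply/afixP/asboolP => [fx g|fx _ /HP[g ->]]; last by rewrite /= apermE permE.
by have := fx _ (pmH g); rewrite /= apermE permE.
Qed.

Lemma expg_acts_trivially : exists k, forall g t, a (g ^+ (p ^ k))%g t = t.
Proof.
have [k cH] := card_H; exists k => g t.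
have pmX m : pm (g ^+ m)%g = (pm g ^+ m)%g.
  by elim: m => [|m IH]; rewrite ?pm1 // expgSr pmM IH -expgS.
by rewrite -[LHS](permE (can_inj (aK _))) -/(pm _) pmX -cH (expg_cardG (pmH g : _ \in HG)) perm1.
Qed.

End FiniteAction.

Lemma ltn_count (T : eqType) (P Q : pred T) (a : T) (s : seq T) :
  (forall x, P x -> Q x) -> a \in s -> Q a -> ~~ P a ->
  (count P s < count Q s)%N.
Proof.
move=> PQ + Qa nPa; elim: s => //= x s IH; rewrite inE => /predU1P[<-|/IH lt].
  by rewrite Qa (negbTE nPa) add0n add1n ltnS; exact: sub_count.
by rewrite -addnS leq_add //; case: (boolP (P x)) => // /PQ ->.
Qed.

(** The cyclic p-group generated by [f] has no fixed point, so the orbit count modulo p is zero. *)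
Lemma prime_order_card (p : nat) (T : finType) (f : T -> T) : prime p ->
  injective f -> (forall t, iter p f t = t) -> (forall t, f t <> t) -> (p %| #|T|)%N.
Proof.
move=> p_pr injf fp fN; pose s := perm injf.
have sX m t : (s ^+ m)%g t = iter m f t.
  by elim: m => [|m IH]; rewrite ?perm1 // expgSr permM IH permE.
have ps : (p.-group <[s]>)%g.
  rewrite /pgroup; apply: (@pnat_dvd _ p); last by rewrite pnat_id.
  by rewrite -orderE order_dvdn; apply/eqP/permP => t; rewrite sX fp perm1.
have as_ : [acts cycle s, on finset.setTfor T | perm_action T]%act.
  by apply/actsP => ? _ t; rewrite !finset.in_setT.
have := pgroup_fix_mod ps as_; rewrite cardsT => cT.
rewrite /dvdn cT (eq_card0 _) ?mod0n // => t.
rewrite finset.in_setI finset.in_setT andTb; apply/negP => /afixP/(_ s (cycle_id s)).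
by rewrite /= apermE permE; exact: fN.
Qed.

(** * Composition series with factors of order p *)

Section Composition.
Variables (p : nat) (G : topGroupType) (M : discreteModType G).
Hypotheses (p_pr : prime p) (Gp : pro_p_group p G).
Implicit Types S : set M.

(* The p-group [G] acts on the finite set S/S', whose cardinal is divisible by p,
   hence it has a fixed point other than [0]. *)
Lemma submodule_fixed_coset S S' : finite_set S -> submodule S -> submodule S' ->
  S' `<=` S -> S' <> S -> (forall a, S a -> exists k, a *+ (p ^ k) = 0) ->
  exists a, [/\ S a, ~ S' a, S' (a *+ p) & forall g, S' (act g a - a)].
Proof.
move=> fS sS sS' S'S S'NS torS.
have [[S0 SB Sg] [S'0 S'B S'g]] := (sS, sS').
(* Among the multiples of [x] by powers of p, the last one outside [S'] has order p modulo [S']. *)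
have last_pow x : S x -> ~ S' x ->
    exists i, ~ S' (x *+ (p ^ i)) /\ S' (x *+ (p ^ i) *+ p).
  move=> Sx nS'x; have [k xk0] := torS x Sx.
  have ex : exists k, `[<S' (x *+ (p ^ k))>] by exists k; apply/asboolP; rewrite xk0.
  case: (ex_minnP ex) => -[|i] /asboolP S'i mini; first by rewrite mulr1n in S'i.
  exists i; split; last by rewrite -mulrnA -expnSr.
  by move=> /asboolP/mini; rewrite ltnn.
have [b [Sb nS'b S'pb]] : exists b, [/\ S b, ~ S' b & S' (b *+ p)].
  have [x Sx nS'x] : exists2 x, S x & ~ S' x.
    apply: contrapT => nx; apply: S'NS; apply/seteqP; split=> // x Sx.
    by apply: contrapT => nS'x; apply: nx; exists x.
  have [i [ni Si]] := last_pow x Sx nS'x.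
  by exists (x *+ p ^ i); split=> //; exact: submoduleMn.
have S'eq x y : S' (x - y) -> S' (y - x).
  by move=> xy; rewrite -opprB; exact: submoduleN.
have S'tr x y z : S' (x - y) -> S' (y - z) -> S' (x - z).
  by move=> xy yz; rewrite -(subrK y x) -addrA; exact: submoduleD.
have [T [q [s [Ss qs qP]]]] :
    exists (T : finType) (q : M -> T) (s : T -> M), [/\ forall t, S (s t),
      forall t, q (s t) = t & forall x y, S x -> S y -> q x = q y <-> S' (x - y)].
  pose cl x := [set y | S' (y - x)].
  have [||T [q [s [_ Ss qs qP]]]] := @finite_quotient M (set M) S cl.
  - by exists 0.
  - exact: finite_image.
  exists T, q, s; split=> // x y Sx Sy; split=> [/(qP x y Sx Sy) xy|xy].
    have : cl x x by rewrite /cl /= subrr.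
    by rewrite xy.
  apply/(qP x y Sx Sy); apply/seteqP; split=> z zx.
    exact: S'tr zx xy.
  by apply: S'tr zx _; exact: S'eq.
have qs' x : S x -> S' (s (q x) - x) by move=> Sx; apply/qP; rewrite ?qs.
pose aT g t := q (act g (s t)).
have aTq g x : S x -> aT g (q x) = q (act g x).
  move=> Sx; apply/qP; [exact: Sg|exact: Sg|].
  by rewrite -actB; apply: S'g; exact: qs'.
(* Translation by [b] permutes the quotient of [S] by [S'] without fixed points, and its p-th
   iterate is the identity. *)
have pT : (p %| #|T|)%N.
  have fq x : S x -> q (s (q x) + b) = q (x + b).
    move=> Sx; apply/qP; [exact: submoduleD|exact: submoduleD|].
    by rewrite opprD addrACA subrr addr0; exact: qs'.
  apply: (prime_order_card p_pr (f := fun t => q (s t + b))) => [t u|t|t].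
  - move/qP => tu; rewrite -(qs t) -(qs u); apply/qP => //.
    have := tu (submoduleD sS (Ss t) Sb) (submoduleD sS (Ss u) Sb).
    by rewrite opprD addrACA subrr addr0.
  - have it m : iter m (fun t => q (s t + b)) t = q (s t + b *+ m).
      elim: m => [|m IH]; first by rewrite mulr0n addr0 qs.
      rewrite iterS IH fq -?addrA -?mulrSr //.
      by apply: submoduleD => //; exact: submoduleMn.
    rewrite it -[RHS]qs; apply/qP => //; last by rewrite addrAC subrr add0r.
    by apply: submoduleD => //; exact: submoduleMn.
  - rewrite -[X in _ = X]qs => /qP; rewrite addrAC subrr add0r => H.
    by apply: nS'b; apply: H => //; exact: submoduleD.
have aT1 t : aT 1%g t = t by rewrite /aT act1 qs.
have aTM g h t : aT (g * h)%g t = aT g (aT h t).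
  rewrite /aT actM; apply/qP; [exact/Sg/Sg|exact: Sg|].
  by rewrite -actB; apply/S'g/S'eq/qs'/Sg.
have aT_lc t : locally_constant (aT^~ t).
  apply: (locally_constant_map q); apply: (locally_constant_act (f := fun=> s t)).
    exact: continuous_idfun.
  exact: locally_constant_cst.
have cF := card_fixed_points p_pr Gp aT1 aTM aT_lc; set F := finset _ in cF.
have pF : (p %| #|F|)%N by rewrite /dvdn -cF; exact: pT.
have q0F : q 0 \in F.
  by rewrite finset.in_set; apply/asboolP => g; rewrite aTq // act0.
have [t tF tq0] : exists2 t, t \in F & t != q 0.
  apply/exists_inP; apply: contraLR pF => /exists_inPn F0.
  have -> : F = finset.set1 (q 0).
    apply/setP => t; rewrite finset.in_set1; apply/idP/eqP => [tF|-> //].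
    by apply/eqP; have := F0 t tF; rewrite negbK.
  by rewrite cards1 dvdn1; apply: contraL p_pr => /eqP ->.
have Sst := Ss t.
have nS't : ~ S' (s t).
  by move=> S'st; case/eqP: tq0; rewrite -(qs t); apply/qP; rewrite ?subr0.
have fixt g : S' (act g (s t) - s t).
  move: tF; rewrite finset.in_set => /asboolP/(_ g); rewrite /aT => tg.
  by apply/qP; rewrite ?qs //; exact: Sg.
(* The fixed coset may have order a higher power of p; its last multiple outside [S'] is still fixed
   and is killed by p. *)
have [i [ni Si]] := last_pow _ Sst nS't.
exists (s t *+ p ^ i); split=> // [|g]; first exact: submoduleMn.
by rewrite actMn -mulrnBl; exact: submoduleMn.
Qed.

(** Natural multiples suffice once [a *+ p] lies in [S]: the factor [p.-1] then stands for -1. *)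
Definition extension S (a : M) : set M := [set x | exists i : nat, S (x - a *+ i)].

Lemma extension_sub S a : S `<=` extension S a.
Proof. by move=> x Sx; exists 0%N; rewrite mulr0n subr0. Qed.

Lemma extension_gen S a : submodule S -> extension S a a.
Proof. by case=> S0 _ _; exists 1%N; rewrite mulr1n subrr. Qed.

Lemma extension_memB S a x y i j : submodule S -> S (a *+ p) ->
  S (x - a *+ i) -> S (y - a *+ j) -> S (x - y - a *+ (i + j * p.-1)).
Proof.
move=> sS pa xi yj; have [_ SB _] := sS.
have -> : x - y - a *+ (i + j * p.-1) = (x - a *+ i) - (y - a *+ j) - a *+ p *+ j.
  have -> : a *+ p *+ j = a *+ j + a *+ (j * p.-1).
    by rewrite -mulrnA -mulrnDr -mulnS prednK ?prime_gt0 // mulnC.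
  rewrite mulrnDr; move: (a *+ i) (a *+ j) (a *+ (j * p.-1)) => A J C.
  by rewrite !opprD opprK !addrA addrK (addrAC x).
by apply: (SB); [exact: SB|exact: submoduleMn].
Qed.

Lemma extension_mem_act S a g x i : submodule S -> S (act g a - a) ->
  S (x - a *+ i) -> S (act g x - a *+ i).
Proof.
move=> sS ga xi; have [_ _ Sg] := sS.
have -> : act g x - a *+ i = act g (x - a *+ i) + (act g a - a) *+ i.
  by rewrite actB actMn mulrnBl addrA subrK.
by apply: submoduleD => //; [exact: Sg|exact: submoduleMn].
Qed.

Lemma submodule_extension S a : submodule S -> S (a *+ p) ->
  (forall g, S (act g a - a)) -> submodule (extension S a).
Proof.
move=> sS pa ga; split=> [|x y [i xi] [j yj]|g x [i xi]].
- by apply: extension_sub; case: sS.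
- by exists (i + j * p.-1)%N; exact: extension_memB.
- by exists i; exact: extension_mem_act.
Qed.

(** Induction along a composition series from [0] to [S]: each step adjoins an element fixed modulo
    the previous term, so fewer elements of [S] are left outside. *)
Lemma submodule_ind S (R : set M -> Prop) : finite_set S -> submodule S ->
  (forall a, S a -> exists k, a *+ (p ^ k) = 0) ->
  R [set 0] ->
  (forall S' a, submodule S' -> S' `<=` S -> S a -> ~ S' a -> S' (a *+ p) ->
     (forall g, S' (act g a - a)) -> R S' -> R (extension S' a)) ->
  R S.
Proof.
move=> fS sS torS R0 Rext; have [S0 _ _] := sS.
have [s Ss] := (iffLR (finite_seqP S)) fS.
pose out S' := count (fun x => ~~ `[<S' x>]) s.
suff main n S' : (out S' < n)%N -> submodule S' -> S' `<=` S -> R S' -> R S.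
  by apply: (main (out [set 0]).+1 [set 0]) => // [|_ ->//]; exact: submodule0.
elim: n S' => // n IH S' outn sS' S'S RS'.
have [<- //|S'NS] := pselect (S' = S).
have [a [Sa nS'a S'pa S'ga]] := submodule_fixed_coset fS sS sS' S'S S'NS torS.
have ext_sub : extension S' a `<=` S.
  move=> x [i xi]; rewrite -(subrK (a *+ i) x).
  by apply: submoduleD => //; [exact: S'S|exact: submoduleMn].
apply: (IH (extension S' a)) => //.
- rewrite -ltnS; apply: leq_trans outn; rewrite ltnS.
  apply: (@ltn_count _ _ _ a) => [x|||].
  + by apply: contra => /asboolP S'x; apply/asboolP; exact: extension_sub.
  + by move: Sa; rewrite {1}Ss.
  + by apply/asboolP.
  + by rewrite negbK; apply/asboolP; exact: extension_gen.
- exact: submodule_extension.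
- exact: Rext.
Qed.
End Composition.

Section ExtensionCoord.
Variables (p : nat) (G : topGroupType) (M : discreteModType G) (S : set M) (a : M).
Hypotheses (p_pr : prime p) (sS : submodule S) (nSa : ~ S a) (Spa : S (a *+ p)).
Hypothesis ga : forall g, S (act g a - a).

(** The order of [a] modulo [S] is exactly p: a Bezout relation with [n] prime to p would put [a]
    itself into [S]. *)
Let mult_in n : S (a *+ n) -> (p %| n)%N.
Proof.
move=> Sn; apply: contrapT => /negP; rewrite -prime_coprime // => cop.
have n0 : (0 < n)%N.
  case: (posnP n) cop => [->|//]; rewrite /coprime gcdn0 => /eqP p1.
  by have := prime_gt1 p_pr; rewrite p1.
have [b c bc _] := egcdnP p n0; apply: nSa.
have -> : a = a *+ n *+ b - a *+ p *+ c.
  by rewrite -!mulrnA mulnC bc gcdnC (eqP cop) mulrnDr mulr1n mulnC addrAC subrr add0r.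
by have [_ SB _] := sS; apply: SB; exact: submoduleMn.
Qed.

Lemma extension_coord : exists coord : M -> trivial_module G 'F_p,
  [/\ hom_on (extension S a) coord, forall c : 'F_p, coord (a *+ c) = c &
      forall x, extension S a x -> coord x = 0 -> S x].
Proof.
have [S0 SB Sg] := sS; have p_gt0 := prime_gt0 p_pr.
(* The exponent [i] is an arbitrary choice, unique modulo p by [natF_eq]; outside the extension the
   value [0] is a default. *)
pose coord (x : M) : trivial_module G 'F_p :=
  if pselect (exists i, S (x - a *+ i)) is left h then (projT1 (cid h))%:R else 0.
have natF_eq i j : S (a *+ i - a *+ j) -> i%:R = j%:R :> 'F_p.
  wlog ij : i j / (j <= i)%N => [H Sij|].
    have [/H|/ltnW/H] := leqP j i; first exact.
    by move=> -> //; rewrite -opprB; exact: submoduleN.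
  rewrite -mulrnBr // => /mult_in pij; apply/eqP.
  by rewrite -subr_eq0 -natrB // -(dvdn_pcharf (pchar_Fp p_pr)).
have coordE x i : S (x - a *+ i) -> coord x = i%:R.
  move=> xi; rewrite /coord; case: pselect => [h|]; last by case; exists i.
  case: cid => j /= xj; apply: natF_eq.
  rewrite (_ : _ - _ = (x - a *+ i) - (x - a *+ j)); first exact: SB.
  by rewrite opprB [RHS]addrC addrA subrK.
have S_id i : S (a *+ i - a *+ i) by rewrite subrr.
exists coord; split=> [|c|x [i xi]].
- split=> [x y [i xi] [j yj]|g x [i xi]].
    rewrite (coordE _ _ (extension_memB p_pr sS Spa xi yj)) (coordE _ _ xi) (coordE _ _ yj).
    rewrite natrD natrM -subn1 natrB // (pcharf0 (pchar_Fp p_pr)) sub0r.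
    by rewrite mulrN1.
  by rewrite (coordE _ _ (extension_mem_act sS (ga g) xi)) (coordE _ _ xi).
- by rewrite (coordE _ _ (S_id c)) natr_Zp.
- rewrite (coordE _ _ xi) => /eqP; rewrite -(dvdn_pcharf (pchar_Fp p_pr)) => /dvdnP[j ij].
  rewrite -(subrK (a *+ i) x) ij mulnC mulrnA.
  by apply: submoduleD => //; [rewrite -mulrnA mulnC -ij|exact: submoduleMn].
Qed.
End ExtensionCoord.

(** * Classes killed by all homomorphisms to F_p *)

(** The vectors [(theta i v)] form a subspace of a finite-dimensional space, and a vector
    annihilated by all linear relations valid on a subspace belongs to it. *)
Lemma solve_functionals (p : nat) (I : finType) (V : zmodType)
    (theta : I -> V -> 'F_p) (c : I -> 'F_p) :
  (forall i u v, theta i (u - v) = theta i u - theta i v) ->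
  (forall b : I -> 'F_p, (forall v, \sum_i b i * theta i v = 0) ->
     \sum_i b i * c i = 0) ->
  exists v, forall i, theta i v = c i.
Proof.
move=> thB sepc.
pose rv v : 'rV['F_p]_#|I| := \row_j theta (enum_val j) v.
pose crow : 'rV['F_p]_#|I| := \row_j c (enum_val j).
have rvB u v : rv (u - v) = rv u - rv v by apply/rowP => j; rewrite !mxE thB.
have rv0 : rv 0 = 0 by rewrite -(subrr 0) rvB subrr.
have rvD u v : rv (u + v) = rv u + rv v.
  by rewrite -{1}[v]opprK -[- v]sub0r !rvB rv0 sub0r opprK.
have rvZ (b : 'F_p) v : exists u, rv u = b *: rv v.
  exists (v *+ b); rewrite -[in RHS](natr_Zp b) scaler_nat.
  by elim: (b : nat) => [|i IH]; rewrite ?rv0 // !mulrS rvD IH.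
(* [V] may be infinite, but its image is a finite set of row vectors, which become the rows of
   [Mx]. *)
pose im := enum [pred w | `[<exists v, w = rv v>]].
have imP w : reflect (exists v, w = rv v) (w \in im).
  by rewrite mem_enum; exact: asboolP.
pose Mx := \matrix_(i < size im) im`_i.
suff /submxP[D DM] : (crow <= Mx)%MS.
  have [v vE] : exists v, rv v = crow.
    rewrite DM mulmx_sum_row.
    elim: (index_enum _) => [|i r [u IH]]; first by exists 0; rewrite big_nil.
    have /imP[v vi] := mem_nth 0 (ltn_ord i).
    have [u' u'E] := rvZ (D 0 i) v.
    by exists (u' + u); rewrite rvD big_cons IH u'E rowK vi.
  exists v => i; have := congr1 (fun r : 'rV_#|I| => r 0 (enum_rank i)) vE.
  by rewrite !mxE enum_rankK.
(* Each column of the cokernel matrix of [Mx] is a relation among the [theta i], hence annihilates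
   [c]. *)
rewrite submxE; apply/eqP/rowP => j; rewrite mxE [RHS]mxE.
have sumE (h : I -> 'F_p) : \sum_k h (enum_val k) * cokermx Mx k j =
    \sum_i cokermx Mx (enum_rank i) j * h i.
  rewrite (reindex_onto enum_rank enum_val) => [|k _]; last exact: enum_valK.
  rewrite (eq_bigl xpredT) => [|i]; last by rewrite enum_rankK eqxx.
  by apply: eq_bigr => i _; rewrite enum_rankK mulrC.
under eq_bigr => k _ do rewrite mxE.
rewrite sumE; apply: sepc => v; rewrite -sumE.
have /imP/(nthP 0)[i ilt iE] : exists u, rv v = rv u by exists v.
have := congr1 (fun A : 'M_(_, _) => A (Ordinal ilt) j) (mulmx_coker Mx).
rewrite !mxE => E0; rewrite -[RHS]E0.
by apply: eq_bigr => k _; rewrite !mxE iE mxE.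
Qed.

Section Poincare.
Variables (p m : nat) (G : topGroupType).
Hypotheses (p_pr : prime p) (Gp : pro_p_group p G).
Notation k := (trivial_module G 'F_p).

(* [Phi] is the isomorphism of H^(m+1)(G, F_p) with F_p, read on cocycles, and
   [PhiN] the nondegeneracy of the cup product in degrees 1 and m. *)
Variable Phi : (('I_m.+1 -> G) -> k) -> 'F_p.
Hypothesis PhiB : forall x y, x \in @is_cocycle G k m.+1 ->
  y \in @is_cocycle G k m.+1 -> Phi (x - y) = Phi x - Phi y.
Hypothesis Phi0 : forall x, x \in @is_cocycle G k m.+1 ->
  Phi x = 0 <-> trivial_in setT x.
Hypothesis PhiN : forall f : G -> 'F_p, locally_constant f ->
  (forall g h, f (g * h)%g = f g + f h) ->
  (forall w, w \in @is_cocycle G k m ->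
     Phi (fun x => f (x ord0) * w (tailx x)) = 0) ->
  forall g, f g = 0.

Lemma is_cocycleP (A : discreteModType G) n (x : ('I_n -> G) -> A) :
  reflect (continuous_cochain x /\ coboundary x = 0) (x \in @is_cocycle G A n).
Proof. exact: asboolP. Qed.

Lemma is_cocycle_coboundary (A : discreteModType G) n (z : ('I_n -> G) -> A) :
  continuous_cochain z -> coboundary z \in @is_cocycle G A n.+1.
Proof.
by move=> cz; apply/is_cocycleP; rewrite coboundaryK; split=> //; exact: continuous_coboundary.
Qed.

Lemma is_cocycle_hom (A B : discreteModType G) (S : set A) (h : A -> B) n
    (x : ('I_n -> G) -> A) : submodule S -> hom_on S h -> (forall t, S (x t)) ->
  x \in @is_cocycle G A n -> (h \o x : _ -> B) \in @is_cocycle G B n.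
Proof.
move=> sS hh Sx /is_cocycleP[cx dx]; apply/is_cocycleP.
split; first exact: continuous_cochain_map.
by apply/funext => t; rewrite (coboundary_hom sS hh) // dx (hom_on0 sS hh).
Qed.

Let PhiZ : Phi 0 = 0.
Proof. by rewrite -(subrr 0) PhiB ?rpred0 // subrr. Qed.

Let PhiD x y : x \in @is_cocycle G k m.+1 -> y \in @is_cocycle G k m.+1 ->
  Phi (x + y) = Phi x + Phi y.
Proof.
move=> cx cy; rewrite -{1}[y]opprK -[- y]sub0r !PhiB ?rpredB ?rpred0 //.
by rewrite PhiZ sub0r opprK.
Qed.

Let PhiMn x n : x \in @is_cocycle G k m.+1 -> Phi (x *+ n) = Phi x *+ n.
Proof.
move=> cx; elim: n => [|n IH]; first by rewrite !mulr0n PhiZ.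
by rewrite !mulrS PhiD ?rpredMn // IH.
Qed.

Let Phi_sum (I : finType) (b : I -> 'F_p) (x : I -> ('I_m.+1 -> G) -> k) :
  (forall i, x i \in @is_cocycle G k m.+1) ->
  Phi (\sum_i x i *+ (b i : 'F_p)) = \sum_i b i * Phi (x i).
Proof.
move=> cx; elim: (index_enum _) => [|i r IH]; first by rewrite !big_nil PhiZ.
rewrite !big_cons PhiD ?PhiMn ?IH //.
- by rewrite -mulr_natl natr_Zp.
- by apply: rpredMn; exact: cx.
- by apply: rpred_sum => j _; apply: rpredMn; exact: cx.
Qed.

Section Extension.
Variables (M : discreteModType G) (S : set M) (a : M).
Hypotheses (sS : submodule S) (fS : finite_set S) (pa : a *+ p = 0).
Hypothesis ga : forall g, S (act g a - a).

Let am (c : k) : M := a *+ (c : 'F_p).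

Let am_nat i : am i%:R = a *+ i.
Proof.
rewrite /am val_Fp_nat // {2}(divn_eq i p) mulrnDr mulnC mulrnA pa mul0rn add0r.
by [].
Qed.

Let amB c d : am (c - d) = am c - am d.
Proof.
suff amD c' d' : am (c' + d') = am c' + am d'.
  by rewrite -{2}(subrK d c) [in RHS]amD addrK.
by rewrite {2 3}/am -mulrnDr -am_nat natrD !natr_Zp.
Qed.

(** The map [c |-> c a] is equivariant for the trivial action on [M], not in general for the given
    one; the defect is measured by [g a - a]. *)
Let am_hom : hom_on (A := k) (B := trivial_module G M) setT am.
Proof. by split=> // c d _ _; exact: amB. Qed.

Variable coord : M -> k.
Hypothesis coord_hom : hom_on (B := k) (extension S a) coord.
Hypothesis coord_gen : forall c : 'F_p, coord (a *+ c) = c.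
Hypothesis coord_in : forall x, extension S a x -> coord x = 0 -> S x.

Let act_am g c : S (act g (am c) - am c).
Proof.
by rewrite actMn -mulrnBl; exact: submoduleMn.
Qed.

Let sE : submodule (extension S a).
Proof.
by apply: (submodule_extension p_pr sS) => //; rewrite pa; case: sS.
Qed.

Let Eam c : extension S a (am c).
Proof. by apply: (submoduleMn _ sE); exact: extension_gen. Qed.

Let coordP x : extension S a x -> S (x - am (coord x)).
Proof.
have [_ EB _] := sE; move=> Ex; apply: coord_in; first exact: EB.
by rewrite coord_hom.1 // coord_gen subrr.
Qed.

(** [am \o w] lifts [w] to the extension. The second term lies in [S], and for a cocycle [w] it
    represents the image of its class under the connecting map. *)
Let coboundary_am n (w : ('I_n -> G) -> k) t : coboundary (am \o w) t =
  am (coboundary w t) + (act (t ord0) (am (w (tailx t))) - am (w (tailx t))).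
Proof.
rewrite -(coboundary_hom (submoduleT k) am_hom) //.
rewrite [RHS]addrC /coboundary [RHS]addrA; congr (_ + _).
exact: esym (subrK _ _).
Qed.

(** The projection [x - am (coord x)] onto [S] is equivariant up to multiples of [g a - a], which
    [h] kills. *)
Let hom_extend (h : M -> k) : hom_on S h -> (forall g, h (act g a - a) = 0) ->
  hom_on (extension S a) (fun x => h (x - am (coord x))).
Proof.
move=> hh ha; have [_ _ Sg] := sS; split=> [x y Ex Ey|g x Ex].
  rewrite coord_hom.1 // amB (_ : _ - _ = (x - am (coord x)) - (y - am (coord y))).
    by apply: hh.1; exact: coordP.
  by rewrite !opprD !opprK addrACA.
rewrite coord_hom.2 //.
rewrite -(subrK (act g (am (coord x))) (act g x)) -[act g (coord x)]/(coord x).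
rewrite -addrA -actB (hom_onD sS hh (Sg g _ (coordP Ex)) (act_am g _)).
rewrite actMn -mulrnBl (hom_onMn sS hh) // ha mul0rn addr0.
by apply: hh.2; exact: coordP.
Qed.

Hypothesis PS : forall x : ('I_m.+1 -> G) -> M, x \in @is_cocycle G M m.+1 ->
  (forall t, S (x t)) ->
  (forall h : M -> k, hom_on S h -> trivial_in setT (h \o x : _ -> k)) ->
  trivial_in S x.

Let cocycle_am (w : ('I_m -> G) -> k) : w \in @is_cocycle G k m ->
  forall t, coboundary (am \o w) t =
    act (t ord0) (am (w (tailx t))) - am (w (tailx t)).
Proof.
move=> /is_cocycleP[_ dw] t; rewrite coboundary_am dw.
by rewrite [am _]mulr0n add0r.
Qed.

(** On the finite set [S] a homomorphism is given by its table of values. The index set consists of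
    all tables; those that come from no homomorphism are sent to the zero map. *)
Let finite_homs : exists (I : finType) (L : I -> M -> k),
  (forall i, hom_on S (L i)) /\
  forall h : M -> k, hom_on S h -> exists i, forall x, S x -> h x = L i x.
Proof.
have [s Ss] := (iffLR (finite_seqP S)) fS.
have rep (i : {ffun seq_sub s -> 'F_p}) : exists h : M -> k, hom_on S h /\
    forall h' : M -> k, hom_on S h' -> (forall u, h' (val u) = i u) ->
    forall x, S x -> h' x = h x.
  have [[h [hh hi]]|noh] := pselect (exists h : M -> k,
      hom_on S h /\ forall u, h (val u) = i u).
    exists h; split=> // h' hh' h'i x Sx.
    have xs : x \in s by move: Sx; rewrite {1}Ss.
    by rewrite -[x]/(val (SeqSub xs)) h'i hi.
  exists (fun=> 0); split; first by split=> // *; rewrite subr0.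
  by move=> h' hh' h'i; case: noh; exists h'.
have [L LP] := choice rep.
exists {ffun seq_sub s -> 'F_p}, L; split=> [i|h hh]; first exact: (LP i).1.
exists [ffun u : seq_sub s => h (val u) : 'F_p].
by apply: (LP _).2 => // u; rewrite ffunE.
Qed.

Lemma killed_by_homs_extension (x : ('I_m.+1 -> G) -> M) :
  x \in @is_cocycle G M m.+1 -> (forall t, extension S a (x t)) ->
  (forall h : M -> k, hom_on (extension S a) h -> trivial_in setT (h \o x : _ -> k)) ->
  trivial_in (extension S a) x.
Proof.
move=> zx Ex killed; have [S0 SB Sg] := sS.
have [w [cw _ dw]] := killed _ coord_hom.
(* As [w] bounds the coordinate of [x], this cohomologous cocycle takes its values in [S]. *)
pose x1 := x - coboundary (am \o w).
have c_am n (v : ('I_n -> G) -> k) : continuous_cochain v -> continuous_cochain (am \o v).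
  exact: continuous_cochain_map.
have zx1 : x1 \in @is_cocycle G M m.+1.
  by apply: rpredB => //; apply/is_cocycle_coboundary/c_am.
have Sx1 t : S (x1 t).
  rewrite (_ : x1 t = x t - coboundary (am \o w) t) // coboundary_am dw opprD addrA.
  by apply: SB; [exact: coordP|exact: act_am].
have [I [L [hL LP]]] := finite_homs.
(* The image of [v] under the connecting map, pushed to F_p by [L i] and evaluated by [Phi]. *)
pose theta i (v : cocycle k m) := Phi (L i \o coboundary (am \o v)).
have zv (v : cocycle k m) : val v \in @is_cocycle G k m by exact: cocycleP.
have cv (v : cocycle k m) : continuous_cochain (val v).
  by have /is_cocycleP[] := zv v.
have zam (v : cocycle k m) : coboundary (am \o v) \in @is_cocycle G M m.+1.
  exact/is_cocycle_coboundary/c_am/cv.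
have Sam (v : cocycle k m) t : S (coboundary (am \o v) t).
  by rewrite cocycle_am; [exact: act_am|exact: zv].
have zL i y : y \in @is_cocycle G M m.+1 -> (forall t, S (y t)) ->
    (L i \o y : _ -> k) \in @is_cocycle G k m.+1.
  by move=> zy Sy; apply: is_cocycle_hom Sy zy.
have LB i y z : (forall t, S (y t)) -> (forall t, S (z t)) ->
    L i \o (y - z) = (L i \o y : _ -> k) - (L i \o z : _ -> k).
  by move=> Sy Sz; apply/funext => t; exact: (hL i).1.
have [v vE] : exists v, forall i, theta i v = Phi (L i \o x1).
  apply: solve_functionals => [i u v|b b0].
    rewrite /theta (_ : am \o (u - v) = (am \o u) - (am \o v)); last first.
      by apply/funext => t; exact: amB.
    by rewrite coboundaryB LB // PhiB //; exact: zL.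
  (* A relation [b] among the [theta i] is a single homomorphism [h] whose composite with the
     connecting map vanishes. *)
  pose h : M -> k := fun y => \sum_i L i y *+ (b i : 'F_p).
  have hh : hom_on S h.
    split=> [y z Sy Sz|g y Sy].
      rewrite /h -sumrB; apply: eq_bigr => i _.
      by rewrite (hL i).1 // mulrnBl.
    rewrite [RHS]/=; apply: eq_bigr => i _.
    by rewrite (hL i).2.
  have hE y : h \o y = \sum_i (L i \o y : ('I_m.+1 -> G) -> k) *+ (b i : 'F_p).
    apply/funext => t; rewrite /h /= fct_sumE; apply: eq_bigr => i _.
    elim: (b i : nat) => [//|n IH]; rewrite !mulrS IH.
    by [].
  have h_act_am g c : h (act g (am c) - am c) = (h (act g a - a) : 'F_p) * c.
    rewrite actMn -mulrnBl (hom_onMn sS hh) //.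
    by rewrite -[LHS]mulr_natr natr_Zp.
  have ha g : h (act g a - a) = 0.
    (* This homomorphism from [G] to F_p has zero cup product with every class of degree [m], so
       nondegeneracy makes it zero. *)
    apply: (PhiN (f := fun g => h (act g a - a))) => [|g1 g2|u zu].
    - apply: (locally_constant_map (fun y => h (y - a))).
      by apply: (locally_constant_act (f := fun=> a)) => y; [exact: cvg_id|exact: nearW].
    - rewrite actM -(subrK (act g1 a) (act g1 (act g2 a))) -actB -addrA.
      rewrite (hom_onD sS hh (Sg g1 _ (ga g2)) (ga g1)).
      by rewrite hh.2 // addrC.
    - rewrite -[RHS](b0 (Cocycle zu)) /theta -Phi_sum -?hE; last by move=> i; exact: zL.
      congr Phi; apply/funext => t.
      by rewrite [RHS]/= cocycle_am // h_act_am.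
  have h'hom := hom_extend hh ha.
  have h_act g c : h (act g (am c) - am c) = 0 by rewrite h_act_am ha mul0r.
  (* The extension of [h] has the same values on [x] as [h] has on [x1], so the assumption on [x]
     makes [h \o x1] trivial. *)
  have hx1 : (fun y => h (y - am (coord y))) \o x = (h \o x1 : _ -> k).
    apply/funext => t /=.
    rewrite (_ : x1 t = x t - coboundary (am \o w) t) // coboundary_am dw opprD addrA /=.
    by rewrite [RHS](hh.1 _ _ (coordP (Ex t)) (act_am _ _)) h_act subr0.
  rewrite -Phi_sum -?hE; last by move=> i; exact: zL.
  apply/Phi0; first exact: is_cocycle_hom Sx1 zx1.
  by rewrite -hx1; exact: killed.
have S_am t : S (coboundary (am \o v) t) := Sam v t.
have [z [cz Sz dz]] : trivial_in S (x1 - coboundary (am \o v)).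
  (* Every homomorphism agrees on [S] with some [L i], and [v] was chosen so that [Phi] vanishes on
     the resulting cocycle. *)
  apply: PS => [|t|h hh]; first exact: rpredB.
    by apply: SB; [exact: Sx1|exact: S_am].
  have [i hL_i] := LP _ hh.
  have zx2 : (x1 - coboundary (am \o v)) \in @is_cocycle G M m.+1 by exact: rpredB.
  have Sx2 t : S ((x1 - coboundary (am \o v)) t) by apply: SB; [exact: Sx1|exact: S_am].
  have -> : h \o (x1 - coboundary (am \o v)) =
      (L i \o (x1 - coboundary (am \o v)) : _ -> k).
    by apply/funext => t; exact: hL_i.
  apply/Phi0; first exact: zL.
  by rewrite LB // PhiB; [rewrite -/(theta i v) vE subrr|exact: zL|exact: zL].
exists (z + (am \o v) + (am \o w)); split.
- apply: continuous_cochainD; last exact: c_am.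
  by apply: continuous_cochainD => //; apply: c_am; exact: cv.
- move=> t; apply: (submoduleD sE); first apply: (submoduleD sE).
  + exact/extension_sub/Sz.
  + exact: Eam.
  + exact: Eam.
- by rewrite !coboundaryD dz subrK subrK.
Qed.

End Extension.

Lemma killed_by_homs_trivial (M : discreteModType G) (S : set M)
    (x : ('I_m.+1 -> G) -> M) :
  finite_set S -> submodule S -> (forall a, S a -> a *+ p = 0) ->
  x \in @is_cocycle G M m.+1 -> (forall t, S (x t)) ->
  (forall h : M -> k, hom_on S h -> trivial_in setT (h \o x : _ -> k)) ->
  trivial_in S x.
Proof.
move=> fS sS pS; pose R S' := forall x : ('I_m.+1 -> G) -> M,
  x \in @is_cocycle G M m.+1 -> (forall t, S' (x t)) ->
  (forall h : M -> k, hom_on S' h -> trivial_in setT (h \o x : _ -> k)) ->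
  trivial_in S' x.
apply: (submodule_ind p_pr Gp (R := R) fS sS) =>
  [a Sa|y zy y0 _|S' a sS' S'S Sa nS'a _ ga PS'].
- by exists 1%N; rewrite expn1 pS.
- have -> : y = 0 by apply/funext.
  exact/trivial_in0/submodule0.
- have Spa : S' (a *+ p) by rewrite pS //; case: sS'.
  have [coord [coord_hom coord_gen coord_in]] := extension_coord p_pr sS' nS'a Spa ga.
  move=> y; apply: (killed_by_homs_extension sS' _ _ _ coord_hom) => //.
    exact: sub_finite_set fS.
  exact: pS.
Qed.

End Poincare.

(** * Dimension shifting *)

Lemma torsion_seq (A : zmodType) (s : seq A) : torsion_module A ->
  exists2 k, (0 < k)%N & forall a, a \in s -> a *+ k = 0.
Proof.
move=> torA; elim: s => [|a r [k k0 IH]]; first by exists 1%N.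
have [j j0 aj] := torA a; exists (j * k)%N => [|b]; first by rewrite muln_gt0 j0.
rewrite inE => /predU1P[->|/IH bk]; first by rewrite mulrnA aj mul0rn.
by rewrite mulnC mulrnA bk mul0rn.
Qed.

Section Shift.
Variables (G : topGroupType) (A : discreteModType G).

Definition shift_pred : {pred G -> A} :=
  fun F => `[< locally_constant F /\ F 1%g = 0 >].

Lemma shift_predP (F : G -> A) :
  reflect (locally_constant F /\ F 1%g = 0) (F \in shift_pred).
Proof. exact: asboolP. Qed.

Lemma shift_pred_zmod_closed : zmod_closed shift_pred.
Proof.
split=> [|F F' /shift_predP[lF F1] /shift_predP[lF' F'1]]; apply/shift_predP.
  by split=> //; exact: locally_constant_cst.
split; last by change (F 1%g - F' 1%g = 0); rewrite F1 F'1 subrr.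
exact: (locally_constant_map2 (fun a b => a - b) lF lF').
Qed.

HB.instance Definition _ :=
  GRing.isZmodClosed.Build _ shift_pred shift_pred_zmod_closed.

Record shift_fun := ShiftFun {
  fun_of_shift :> G -> A;
  shift_funP : fun_of_shift \in shift_pred
}.

HB.instance Definition _ := [isSub for fun_of_shift].
HB.instance Definition _ := [Choice of shift_fun by <:].
HB.instance Definition _ := [SubChoice_isSubZmodule of shift_fun by <:].

(* The quotient of the coinduced module of locally constant functions [G -> A]
   by [A], embedded by [h |-> h *: a]: a class is represented by its unique
   member vanishing at [1], whence the correction term in the action. The
   compactness of [G] makes the action continuous. *)
Definition shift (cG : compact [set: G]) : Type := shift_fun.

Variable cG : compact [set: G].
Notation Q := (shift cG).

HB.instance Definition _ := GRing.Zmodule.copy Q shift_fun.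

Lemma shift_act_in g (F : Q) :
  (fun h => F (h * g)%g - act h (F g)) \in shift_pred.
Proof.
have /shift_predP[lF F1] := shift_funP F; apply/shift_predP; split.
  apply: (locally_constant_map2 (fun a b => a - b)).
    apply: (locally_constant_comp (g := fun h => (h * g)%g) _ lF).
    by apply: mul_continuous => x; [exact: cvg_id|exact: cvg_cst].
  apply: (locally_constant_act (f := fun=> F g)); last exact: locally_constant_cst.
  by move=> x; exact: cvg_id.
by rewrite mul1g act1 subrr.
Qed.

Definition shift_act g (F : Q) : Q := ShiftFun (shift_act_in g F).

Lemma shift_eq (F F' : Q) : (forall h, F h = F' h) -> F = F'.
Proof. by move=> FF'; apply: val_inj; apply/funext. Qed.

Lemma shift_act1 F : shift_act 1%g F = F.
Proof.
apply: shift_eq => h /=; have /shift_predP[_ ->] := shift_funP F.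
by rewrite mulg1 act0 subr0.
Qed.

Lemma shift_actM g g' F : shift_act (g * g')%g F = shift_act g (shift_act g' F).
Proof.
by apply: shift_eq => h /=; rewrite actB -actM mulgA opprB addrA subrK.
Qed.

Lemma shift_actD g F F' : shift_act g (F + F') = shift_act g F + shift_act g F'.
Proof.
apply: shift_eq => h.
change (F (h * g)%g + F' (h * g)%g - act h (F g + F' g) =
  (F (h * g)%g - act h (F g)) + (F' (h * g)%g - act h (F' g))).
by rewrite actD opprD addrACA.
Qed.

Lemma shift_act_continuous : continuous
  (fun gF : G * discrete_topology Q => shift_act gF.1 gF.2 : discrete_topology Q).
Proof.
apply/discrete_cvgP => -[g F].
have /shift_predP[lF F1] := shift_funP F.
have lc : locally_constant (fun g' h => F (h * g')%g - act h (F g')).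
  apply: (locally_constant_tube (f := fun h g' => F (h * g')%g - act h (F g'))) => //.
  have [f1 s1] : continuous (@fst G G) /\ continuous (@snd G G).
    by split; [exact: continuous_fst|exact: continuous_snd].
  apply: (locally_constant_map2 (fun a b => a - b)).
    exact: (locally_constant_comp (mul_continuous f1 s1) lF).
  by apply: locally_constant_act => //; exact: (locally_constant_comp s1 lF).
exists ([set g' | (fun h => F (h * g')%g - act h (F g')) =
                  (fun h => F (h * g)%g - act h (F g))], [set F]) => /=.
  by split; [exact: lc|exact: discrete_set1].
by move=> [g' F'] [/= gg' ->]; apply: val_inj.
Qed.

HB.instance Definition _ := isDiscreteModule.Build G Q
  shift_act1 shift_actM shift_actD shift_act_continuous.

Lemma shiftB (F F' : Q) h : (F - F') h = F h - F' h. Proof. by []. Qed.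

Lemma shift_sum (I : Type) (r : seq I) (f : I -> Q) h :
  (\sum_(i <- r) f i) h = \sum_(i <- r) f i h.
Proof. by elim: r => [|i r IH]; rewrite ?big_nil // !big_cons -IH. Qed.

Lemma shiftMn (F : Q) n h : (F *+ n) h = F h *+ n.
Proof. by elim: n => [|n IH] //; rewrite !mulrS -IH. Qed.

Lemma shiftMz (F : Q) z h : (F *~ z) h = F h *~ z.
Proof.
case: z => n; first exact: shiftMn.
rewrite NegzE !mulrNz; change (- ((F *+ n.+1 : Q) h) = - (F h *+ n.+1)).
by rewrite shiftMn.
Qed.

Lemma shift_torsion : torsion_module A -> torsion_module Q.
Proof.
move=> torA F; have /shift_predP[lF F1] := shift_funP F.
have [s sE] := (iffLR (finite_seqP _)) (finite_range_locally_constant cG lF).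
have [k k0 ks] := torsion_seq s torA.
exists k => //; apply: shift_eq => h; rewrite shiftMn; apply: ks.
have : range F (F h) by exists h.
by rewrite sE.
Qed.

Section Cocycle.
Variables (q : nat) (f : ('I_q.+1 -> G) -> A).

Lemma cons1_locally_constant n (e : ('I_n.+1 -> G) -> A) (h : G) :
  continuous_cochain e ->
  locally_constant ((fun x => e (consx h x)) : {ptws 'I_n -> G} -> A).
Proof.
move=> /continuous_cochainP le.
have ch : continuous (fun x : {ptws 'I_n -> G} => (h, x)).
  by apply: continuous_pair; [exact: continuous_const|exact: continuous_idfun].
exact: (locally_constant_comp (continuous_compose ch (@consx_continuous G n)) le).
Qed.

Hypothesis zf : f \in @is_cocycle G A q.+1.

Let cf : continuous_cochain f. Proof. by have /asboolP[] := zf. Qed.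

Let df t : coboundary f t = 0. Proof. by have /asboolP[_ ->] := zf. Qed.

Let lf : locally_constant
  (fun hx : G * {ptws 'I_q -> G} => f (consx hx.1 hx.2)).
Proof.
apply: (locally_constant_comp (@consx_continuous G q)).
exact/continuous_cochainP.
Qed.

Lemma shift_cochain_in x :
  (fun h => f (consx h x) - act h (f (consx 1%g x))) \in shift_pred.
Proof.
apply/shift_predP; split; last by rewrite act1 subrr.
apply: (locally_constant_map2 (fun a b => a - b)).
  apply: (locally_constant_comp (g := fun h => (h, x : {ptws 'I_q -> G})) _ lf).
  by apply: continuous_pair; [exact: continuous_idfun|exact: continuous_const].
apply: (locally_constant_act (f := fun=> f (consx 1%g x))); last exact: locally_constant_cst.
by move=> y; exact: cvg_id.
Qed.

(** The function [h |-> f (h, x)], taken modulo [A] and normalised at [1]. By the cocycle identity,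
    the coboundary of its lift to the coinduced module is [f], so the connecting map sends it to the
    class of [f]. *)
Definition shift_cochain : ('I_q -> G) -> Q := fun x => ShiftFun (shift_cochain_in x).

(** In the cocycle identity with first entry [1], the action term cancels the face that merges this
    entry. *)
Lemma cocycle_cons1 (t : 'I_q.+1 -> G) :
  \sum_(j < q.+1) f (consx 1%g (face j t)) *~ (-1) ^+ j.+1 = 0.
Proof.
have := df (consx 1%g t); rewrite coboundary_cons act1 mul1g -consx_eta.
by rewrite opprD addrA subrr sub0r => /eqP; rewrite oppr_eq0 => /eqP.
Qed.

Lemma shift_cochain_cocycle : shift_cochain \in @is_cocycle G Q q.
Proof.
apply/asboolP; split.
  apply/continuous_cochainP => x.
  have lc : locally_constant (fun (x : {ptws 'I_q -> G}) h =>
      f (consx h x) - act h (f (consx 1%g x))).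
    apply: (locally_constant_tube (f := fun h (x : {ptws 'I_q -> G}) =>
      f (consx h x) - act h (f (consx 1%g x)))) => //.
    apply: (locally_constant_map2 (fun a b => a - b)); first exact: lf.
    apply: locally_constant_act; first exact: continuous_fst.
    exact: (locally_constant_comp (@continuous_snd _ _) (cons1_locally_constant 1%g cf)).
  by apply: filterS (lc x) => y xy; apply: val_inj.
apply/funext => t; apply: shift_eq => h; rewrite /coboundary.
change (shift_act (t ord0) (shift_cochain (tailx t)) h +
  (\sum_(j < q.+1) shift_cochain (face j t) *~ (-1) ^+ j.+1 : Q) h = 0).
rewrite shift_sum /=.
under eq_bigr => j _ do rewrite shiftMz /= mulrzBl -actMz.
rewrite sumrB -act_sum cocycle_cons1 act0 subr0 -consx_eta.
have := df (consx h t); rewrite coboundary_cons => /eqP.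
rewrite subr_eq0 => /eqP E.
rewrite actB -actM opprB addrA subrK E.
by rewrite opprD addrA subrr sub0r addNr.
Qed.
End Cocycle.

Lemma shift_cochain_trivial q (f : ('I_q.+2 -> G) -> A) (zf : f \in @is_cocycle G A q.+2) :
  trivial_in setT (shift_cochain zf) -> trivial_in setT f.
Proof.
move=> [z [cz _ dz]]; have /asboolP[cf df] := zf.
(* A primitive [z] with values in functions on [G] becomes a cochain with one more variable. The
   term [w] undoes the normalisation at [1], and [w - Z] is a primitive of [f]. *)
pose Z : ('I_q.+1 -> G) -> A := fun x => z (tailx x) (x ord0).
pose w : ('I_q.+1 -> G) -> A := fun x => f (consx 1%g x).
have cZ : continuous_cochain Z.
  apply/continuous_cochainP => x; have /continuous_cochainP lz := cz.
  have /shift_predP[lzx _] := shift_funP (z (tailx x)).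
  have lz' := locally_constant_comp (@tailx_continuous G q) lz x.
  have lzx' := @coord_continuous G q.+1 ord0 x _ (lzx (x ord0)).
  by apply: filterS2 lz' lzx' => y; rewrite /Z /= => -> ->.
have cw : continuous_cochain w.
  by apply/continuous_cochainP; exact: cons1_locally_constant.
exists (w - Z); split=> //; first exact: continuous_cochainB.
apply/funext => t; rewrite coboundaryB.
change (coboundary w t - coboundary Z t = f t).
have dw : coboundary w t = act (t ord0) (w (tailx t)).
  by rewrite /coboundary (cocycle_cons1 zf) addr0.
rewrite dw [t]consx_eta coboundary_cons consx0 consxK.
move: (t ord0) (tailx t) => h x.
have E : z (tailx x) (h * x ord0)%g - act h (Z x) +
    \sum_(j < q.+1) z (face j x) h *~ (-1) ^+ j.+1 = f (consx h x) - act h (w x).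
  transitivity (fun_of_shift (coboundary z x) h); last by rewrite dz.
  rewrite /coboundary.
  change (z (tailx x) (h * x ord0)%g - act h (Z x) +
    \sum_(j < q.+1) z (face j x) h *~ (-1) ^+ j.+1 =
    z (tailx x) (h * x ord0)%g - act h (z (tailx x) (x ord0)) +
    (\sum_(j < q.+1) z (face j x) *~ (-1) ^+ j.+1 : Q) h).
  by congr (_ + _); rewrite shift_sum; apply: eq_bigr => j _; rewrite shiftMz.
have -> : Z (consx (h * x ord0)%g (tailx x)) = z (tailx x) (h * x ord0)%g.
  by rewrite /Z consxK consx0.
have -> : \sum_(j < q.+1) Z (consx h (face j x)) *~ (-1) ^+ j.+1 =
    \sum_(j < q.+1) z (face j x) h *~ (-1) ^+ j.+1.
  by apply: eq_bigr => j _; rewrite /Z consxK consx0.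
rewrite opprB addrC -(subrK (act h (w x)) (f _)) -E.
by congr (_ + _); rewrite addrAC.
Qed.
End Shift.

(** * Vanishing above the top degree *)

Section Cosets.
Variables (p : nat) (G : topGroupType) (V : set G).
Hypotheses (p_pr : prime p) (Gp : pro_p_group p G).
Hypotheses (oV : open V) (nV : normal_subgroup V).

Lemma coset_quotient : exists (T : finType) (q : G -> T) (s : T -> G) (k : nat),
  [/\ #|T| = (p ^ k)%N, forall t, q (s t) = t &
      forall x y, q x = q y <-> V (x^-1 * y)%g].
Proof.
have [V1 VM VV VJ] := nV; have [_ _ _ /(_ V oV nV)[k cV]] := Gp.
pose coset x := [set (x * u)%g | u in V].
have fV : finite_set (left_cosets V) by apply/finite_setP; exists (p ^ k)%N.
have [|T [q [s [cT _ qs qP]]]] := @finite_quotient G _ setT coset _ fV.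
  by exists 1%g.
exists T, q, s, k; split=> // [|x y].
  apply/card_eq_II/(card_eq_trans _ cV); rewrite card_eq_sym.
  by rewrite (_ : left_cosets V = coset @` setT).
rewrite qP //; split=> [xy|Vxy].
  have : coset y y by exists 1%g; rewrite ?mulg1.
  by rewrite -xy => -[u Vu <-]; rewrite mulKg.
apply/seteqP; split=> _ [u Vu <-].
  exists ((x^-1 * y)^-1 * u)%g; first by apply: VM => //; exact: VV.
  by rewrite invMg invgK mulgA mulKVg.
by exists (x^-1 * y * u)%g; [exact: VM|rewrite !mulgA mulgV mul1g].
Qed.

(** [G] acts on the cosets of [V] by left translation through a finite p-group, and an element that
    fixes the coset of [1] lies in [V]. *)
Lemma expg_mem_open_normal : exists k, forall g, V (g ^+ (p ^ k))%g.
Proof.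
have [V1 VM VV VJ] := nV; have [T [q [s [_ [_ qs qP]]]]] := coset_quotient.
have qsV x : V ((s (q x))^-1 * x)%g by apply/qP; rewrite qs.
pose a g t := q (g * s t)%g.
have aq g x : a g (q x) = q (g * x)%g.
  by apply/qP; rewrite invMg -mulgA mulKg.
have [|g h t|t|k aP] := @expg_acts_trivially p G T a p_pr Gp.
- by move=> t; rewrite /a mul1g qs.
- by rewrite [a h t]/a aq mulgA.
- move=> g; have cx : continuous (fun h => (h * s t)^-1 * (g * s t))%g.
    apply: mul_continuous; last exact: continuous_const.
    apply: (continuous_compose (f := fun h => (h * s t)%g) (g := fun x => (x^-1)%g)).
      by apply: mul_continuous; [exact: continuous_idfun|exact: continuous_const].
    exact: invg_continuous.
  have gV : nbhs g ((fun h => (h * s t)^-1 * (g * s t))%g @^-1` V).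
    by apply: cx; rewrite mulVg; exact: open_nbhs_nbhs.
  by apply: filterS gV => h hV; apply/qP.
exists k => g; have := aP g (q 1%g); rewrite aq mulg1 => /esym/qP.
by rewrite invg1 mul1g.
Qed.
End Cosets.

Section Transversal.
Variables (p : nat) (G : topGroupType) (V : set G) (u : G).
Hypotheses (p_pr : prime p) (nV : normal_subgroup V) (nVu : ~ V u) (Vup : V (u ^+ p)%g).

Let VMr x y : V x -> V (x * y)%g <-> V y.
Proof.
have [_ VM VV _] := nV; move=> Vx; split=> [Vxy|]; last exact: VM.
by rewrite -(mulKg x y); apply: VM => //; exact: VV.
Qed.

Let VX i : V (u ^+ i)%g <-> (p %| i)%N.
Proof.
have [V1 VM VV _] := nV.
have Vmul j : V (u ^+ (p * j))%g.
  by elim: j => [|j IH]; rewrite ?muln0 // mulnS expgD; exact: VM.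
split=> [Vui|/dvdnP[j ->]]; last by rewrite mulnC.
apply: contrapT => /negP; rewrite -prime_coprime // => cop.
have i0 : (0 < i)%N.
  case: (posnP i) cop => [->|//]; rewrite /coprime gcdn0 => /eqP p1.
  by have := prime_gt1 p_pr; rewrite p1.
have [a b ab _] := egcdnP p i0.
have Vui' j : V (u ^+ (i * j))%g.
  by elim: j => [|j IH]; rewrite ?muln0 // mulnS expgD; exact: VM.
apply: nVu; have := Vui' a; rewrite mulnC ab gcdnC (eqP cop) expgD mulnC.
by move/(VMr _ (Vmul b)); rewrite expg1.
Qed.

Hypotheses (oV : open V) (Gp : pro_p_group p G).

(* [P] selects, in a way that only depends on cosets of [V], exactly one of the
   cosets [h u^j V] for each [h]. *)
Lemma transversal_exists : exists P : G -> bool,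
  (forall h v, V v -> P (h * v)%g = P h) /\
  forall h, exists i : 'I_p, forall j : 'I_p, P (h * u ^+ j)%g = (j == i).
Proof.
have [V1 VM VV VJ] := nV.
have [T [q [s [k [_ qs qP]]]]] := coset_quotient Gp oV nV.
(* Right multiplication by [u] on the cosets, well defined because [V] is normal; all its orbits
   have p elements. *)
pose r t := q (s t * u)%g.
have rq x : r (q x) = q (x * u)%g.
  apply/qP; have /qP Vx : q (s (q x)) = q x by rewrite qs.
  by have := VJ _ u Vx; rewrite conjgE invMg !mulgA.
have rqX x i : iter i r (q x) = q (x * u ^+ i)%g.
  by elim: i => [|i IH]; rewrite ?mulg1 // iterS IH rq expgSr mulgA.
have r_fix t i : iter i r t = t <-> (p %| i)%N.
  rewrite -VX -{1}[t]qs rqX -{2}[t]qs; split=> [/esym/qP|Vi]; first by rewrite mulKg.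
  by apply/esym/qP; rewrite mulKg.
have r_inj : injective r.
  apply: (can_inj (g := iter p.-1 r)) => t.
  by rewrite -iterSr prednK ?prime_gt0 //; apply/r_fix.
(* The chosen coset of each orbit is its canonical root. *)
exists (fun h => q h == froot r (q h)); split=> [h v Vv|h].
  suff -> : q (h * v)%g = q h by [].
  by apply/esym/qP; rewrite mulKg.
have root_iter i : froot r (iter i r (q h)) = froot r (q h).
  by apply/esym/(fingraph.rootP (fconnect_sym r_inj)); exact: fconnect_iter.
have /iter_findex iE : fconnect r (q h) (froot r (q h)) by exact: connect_root.
have ip := ltn_pmod (findex r (q h) (froot r (q h))) (prime_gt0 p_pr).
have iterMod i : iter (i %% p) r (q h) = iter i r (q h).
  rewrite {2}(divn_eq i p) addnC iterD; congr (iter _ _ _).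
  by apply/esym/r_fix; exact: dvdn_mull.
move: iE ip; rewrite -iterMod; move: (_ %% _)%N => i iE ip.
exists (Ordinal ip) => j; rewrite -rqX root_iter -iE.
apply/eqP/eqP => [ij|-> //].
apply: val_inj => /=; have [||//] := ltngtP j i => [ji|ij'].
  move: ij; rewrite -(subnK (ltnW ji)) iterD => /esym/r_fix.
  rewrite gtnNdvd ?subn_gt0 //; exact: leq_ltn_trans (leq_subr _ _) ip.
move: ij; rewrite -(subnK (ltnW ij')) iterD => /r_fix.
rewrite gtnNdvd ?subn_gt0 //; exact: leq_ltn_trans (leq_subr _ _) (ltn_ord j).
Qed.
End Transversal.

Lemma locally_constant_invariant (G : topGroupType) (V : set G) B (F : G -> B) :
  open V -> V 1%g -> (forall g v, V v -> F (g * v)%g = F g) -> locally_constant F.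
Proof.
move=> oV V1 FV g.
have cg : continuous (fun h => g^-1 * h)%g.
  by apply: mul_continuous; [exact: continuous_const|exact: continuous_idfun].
have gV : nbhs g ((fun h => g^-1 * h)%g @^-1` V).
  by apply: cg; rewrite mulVg; exact: open_nbhs_nbhs.
by apply: filterS gV => h /= hV; rewrite -[h](mulKVg g) FV.
Qed.

Lemma trivial_Fp_cocycle (p m : nat) (G : topGroupType) :
  prime p -> pro_p_group p G -> infinite_set [set: G] ->
  (forall (M : discreteModType G) (S : set M) (x : ('I_m.+1 -> G) -> M),
     finite_set S -> submodule S -> (forall a, S a -> a *+ p = 0) ->
     x \in @is_cocycle G M m.+1 -> (forall t, S (x t)) ->
     (forall h : M -> trivial_module G 'F_p, hom_on S h ->
        trivial_in setT (h \o x : _ -> trivial_module G 'F_p)) ->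
     trivial_in S x) ->
  forall f : ('I_m.+2 -> G) -> trivial_module G 'F_p,
    f \in @is_cocycle G (trivial_module G 'F_p) m.+2 -> trivial_in setT f.
Proof.
move=> p_pr Gp infG killed_trivial f zf; have [cG _ _ _] := Gp.
pose Q := shift (trivial_module G 'F_p) cG.
pose y : ('I_m.+1 -> G) -> Q := shift_cochain cG zf.
have zy : y \in @is_cocycle G Q m.+1 by exact: shift_cochain_cocycle.
have charp (c : 'F_p) : c *+ p = 0 by exact: (mulrn_pchar (pchar_Fp p_pr)).
have lcy : locally_constant (fun xh : {ptws 'I_m.+1 -> G} * G => y xh.1 xh.2).
  move=> [x h]; have /shift_predP[ly _] := shift_funP (y x).
  have /asboolP[/continuous_cochainP cy _] := zy.
  exists ([set x' | y x' = y x], [set h' | y x h' = y x h]).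
    by split; [exact: cy|exact: ly].
  move=> [x' h'] [xx hh]; change (y x' h' = y x h).
  by rewrite (xx : y x' = y x); exact: hh.
have [oU nU] := open_normal_invariance (f := fun x : {ptws 'I_m.+1 -> G} => y x)
  cG (ptws_compact cG) lcy.
set U := invariance _ in oU nU.
have yU x g v : U v -> y x (g * v)%g = y x g.
  by move=> Uv; have := Uv x g 1%g; rewrite !mulg1.
have [V [oV nV VU [u0 Uu0 nVu0]]] := open_normal_shrink Gp infG oU nU.
have [V1 VM VV VJ] := nV; have [U1 UM UV _] := nU.
have [u [Uu nVu Vup]] : exists u, [/\ U u, ~ V u & V (u ^+ p)%g].
  have [k Vk] := expg_mem_open_normal p_pr Gp oV nV.
  have ex : exists i, `[<V (u0 ^+ (p ^ i))%g>] by exists k; apply/asboolP.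
  (* The last iterated p-th power of [u0] outside [V] has order p modulo [V]. *)
  case: (ex_minnP ex) => -[|i] /asboolP Vi mini; first by rewrite expg1 in Vi.
  exists (u0 ^+ (p ^ i))%g; split.
  - by elim: (p ^ i)%N => [//|j IH]; rewrite expgS; exact: UM.
  - by move=> /asboolP/mini; rewrite ltnn.
  - by rewrite -expgM -expnSr.
have [P [PV Pu]] := transversal_exists p_pr nV nVu Vup oV Gp.
(* A copy of the functions on G/V modulo constants. It contains the values of [y], which are even
   invariant under [U]. *)
pose S : set Q := [set F | forall g v, V v -> F (g * v)%g = F g].
have sS : submodule S.
  split=> [g v Vv //|F F' SF SF' g v Vv|g F SF h v Vv].
    by rewrite !shiftB SF ?SF'.
  change (F (h * v * g)%g - F g = F (h * g)%g - F g).
  congr (_ - _); have -> : (h * v * g = h * g * v ^ g)%g.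
    by rewrite conjgE !mulgA mulgK.
  by apply: SF; exact: VJ.
have fS : finite_set S.
  have [T [q [s [k [_ qs qP]]]]] := coset_quotient Gp oV nV.
  have rep (i : {ffun T -> 'F_p}) : exists F : Q,
      forall F', S F' -> (forall t, F' (s t) = i t) -> F = F'.
    have [[F [SF Fi]]|noF] := pselect (exists F : Q, S F /\ forall t, F (s t) = i t).
      exists F => F' SF' F'i; apply: shift_eq => g.
      have /qP Vg : q (s (q g)) = q g by rewrite qs.
      by rewrite -(mulKVg (s (q g)) g) SF ?SF' // Fi F'i.
    by exists 0 => F' SF' F'i; case: noF; exists F'.
  have [L LP] := choice rep.
  apply: (sub_finite_set (B := L @` setT)); last exact/finite_image/finite_finset.
  move=> F SF; exists [ffun t => F (s t) : 'F_p] => //.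
  by apply: LP => // t; rewrite ffunE.
apply: (shift_cochain_trivial (cG := cG) (zf := zf)).
apply: (trivial_inW (S := S)) => //.
apply: killed_trivial => //.
- by move=> F _; apply: shift_eq => h; rewrite shiftMn; exact: charp.
- by move=> x g v Vv; apply: yU; exact: VU.
move=> h hh; suff -> : h \o y = (fun=> 0).
  exact/trivial_in0/submoduleT.
apply/funext => x /=; set F := y x.
(* [F] cut down to the transversal: since [F] is invariant under [u], the p translates of [F1] by
   powers of [u] add up to [F]. Subtracting [F1 1] puts it into [Q]. *)
pose F1 g : trivial_module G 'F_p := if P g then F g else 0.
have F1V g v : V v -> F1 (g * v)%g = F1 g.
  by move=> Vv; rewrite /F1 PV // yU //; exact: VU.
have F0_in : (fun g => F1 g - F1 1%g) \in @shift_pred G (trivial_module G 'F_p).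
  apply/shift_predP; split; last by rewrite subrr.
  by apply: (locally_constant_invariant oV V1) => g v Vv; rewrite F1V.
pose F0 : Q := ShiftFun F0_in.
have SF0 : S F0 by move=> g v Vv /=; rewrite F1V.
have uU i g : F (g * u ^+ i)%g = F g.
  apply: yU; elim: i => [//|i IH]; rewrite expgS; exact: UM.
have sumF1 g : \sum_(i < p) F1 (g * u ^+ i)%g = F g.
  have [i Pi] := Pu g; rewrite (bigD1 i) //= big1 ?addr0 => [|j ji].
    by rewrite /F1 Pi eqxx uU.
  by rewrite /F1 Pi (negbTE ji).
(* Being a sum of p translates of [F0], [F] is killed by every homomorphism. *)
have FE : F = \sum_(i < p) act (u ^+ i)%g F0.
  apply: shift_eq => g; rewrite shift_sum.
  have /shift_predP[_ F_1] := shift_funP F.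
  have -> : F g = \sum_(i < p) F1 (g * u ^+ i)%g - \sum_(i < p) F1 (1 * u ^+ i)%g.
    by rewrite !sumF1 F_1 subr0.
  rewrite -sumrB; apply: eq_bigr => i _.
  change (F1 (g * u ^+ i)%g - F1 (1 * u ^+ i)%g =
    (F1 (g * u ^+ i)%g - F1 1%g) - (F1 (u ^+ i)%g - F1 1%g)).
  by rewrite mul1g opprB addrA subrK.
have [_ _ Sg] := sS.
rewrite FE (hom_on_sum sS hh) => [|i _]; last exact: Sg.
under eq_bigr => i _ do rewrite hh.2 //.
by rewrite sumr_const card_ord; exact: charp.
Qed.

(** * Torsion coefficients *)

Lemma act_finite_range (G : topGroupType) (A : discreteModType G) (K : topologicalType)
    (f : K -> A) :
  compact [set: G] -> compact [set: K] -> locally_constant f ->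
  finite_set (range (fun gt : G * K => act gt.1 (f gt.2))).
Proof.
move=> cG cK lf; apply: finite_range_locally_constant.
  by rewrite -setXTT; exact: compact_setX.
apply: locally_constant_act; first exact: continuous_fst.
exact: (locally_constant_comp (@continuous_snd _ _) lf).
Qed.

(** The combinations of a finite stable set have coefficients that only matter modulo [N], so they
    are finite in number, and [N.-1] replaces -1. *)
Lemma generated_submodule (G : topGroupType) (A : discreteModType G) (B : set A) N :
  finite_set B -> (forall g b, B b -> B (act g b)) -> (0 < N)%N ->
  (forall b, B b -> b *+ N = 0) ->
  exists S : set A, [/\ submodule S, finite_set S, B `<=` S &
    forall x, S x -> x *+ N = 0].
Proof.
move=> /finite_seqP[s ->] sB N0 sN.
have {}sN b : b \in s -> b *+ N = 0 by exact: sN.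
pose comb (c : 'I_(size s) -> nat) := \sum_(i < size s) s`_i *+ c i.
pose S := [set x | exists c, x = comb c].
have combN c : comb c *+ N = 0.
  rewrite -sumrMnl big1 // => i _.
  by rewrite -mulrnA mulnC mulrnA sN ?mul0rn // mem_nth.
have SD x y : S x -> S y -> S (x + y).
  move=> [c ->] [d ->]; exists (fun i => (c i + d i)%N).
  by rewrite /comb -big_split; apply: eq_bigr => i _; rewrite mulrnDr.
have S0 : S 0 by exists (fun=> 0%N); rewrite /comb big1.
have SMn x n : S x -> S (x *+ n).
  by move=> Sx; elim: n => [|n IH]; rewrite ?mulr0n // mulrS; exact: SD.
have sS b : b \in s -> S b.
  move=> /(nthP 0)[i ilt <-]; exists (fun j => (j == Ordinal ilt)%N).
  rewrite /comb (bigD1 (Ordinal ilt)) //= eqxx mulr1n big1 ?addr0 // => j /negbTE ->.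
  by rewrite mulr0n.
exists S; split=> [||b|x [c ->]] //; last exact: sS.
- split=> // [x y Sx [c ->]|g x [c ->]].
    have -> : - comb c = comb c *+ N.-1.
      by apply: (addrI (comb c)); rewrite subrr -mulrS prednK // combN.
    by apply: SD => //; apply: SMn; exists c.
  rewrite act_sum; elim/big_ind: _ => [//|x1 x2|i _]; first exact: SD.
  rewrite actMn; apply: SMn; apply: sS; apply: sB; exact: mem_nth.
- apply: (sub_finite_set (B := [set comb (fun i => c i : nat) |
     c in [set: {ffun 'I_(size s) -> 'I_N}]])); last exact/finite_image/finite_finset.
  move=> _ [c ->]; exists [ffun i => Ordinal (ltn_pmod (c i) N0)] => //.
  apply: eq_bigr => i _; rewrite ffunE /=.
  by rewrite {2}(divn_eq (c i) N) mulrnDr mulnC mulrnA sN ?mem_nth // mul0rn add0r.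
Qed.

Section Torsion.
Variables (p r : nat) (G : topGroupType).
Hypotheses (p_pr : prime p) (Gp : pro_p_group p G).
Notation k := (trivial_module G 'F_p).

Lemma coprime_torsion_trivial (A : discreteModType G) (f : ('I_r.+1 -> G) -> A) j :
  f \in @is_cocycle G A r.+1 -> coprime p j -> (forall t, f t *+ j = 0) ->
  trivial_in setT f.
Proof.
move=> zf pj fj; have [cG _ _ _] := Gp; have /asboolP[cf df] := zf.
(* Averaging over G/V the identity [fE] below, deduced from [df], expresses
   [f *+ (p ^ e)] as the coboundary of [W]. *)
pose E h x := act h^-1%g (f (consx h x)).
have lE : locally_constant (fun xh : {ptws 'I_r -> G} * G => E xh.2 xh.1).
  have cs := @continuous_snd {ptws 'I_r -> G} G.
  apply: locally_constant_act.
    exact: (continuous_compose cs (@invg_continuous G)).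
  have cx := continuous_compose (continuous_pair cs (@continuous_fst _ _))
    (@consx_continuous G r).
  by apply: (locally_constant_comp cx); exact/continuous_cochainP.
have [oV nV] := open_normal_invariance (f := fun x : {ptws 'I_r -> G} => E^~ x)
  cG (ptws_compact cG) lE.
set V := invariance _ in oV nV.
have EV g v x : V v -> E (g * v)%g x = E g x.
  by move=> Vv; have := Vv x g 1%g; rewrite !mulg1.
have [T [q [s [e [cT qs qP]]]]] := coset_quotient Gp oV nV.
have Es g x : E (s (q g)) x = E g x.
  have /qP Vg : q (s (q g)) = q g by rewrite qs.
  by rewrite -{2}(mulKVg (s (q g)) g) EV.
have [_ _ _ VJ] := nV.
have qM x y g : q x = q y -> q (x * g)%g = q (y * g)%g.
  by move=> /qP Vxy; apply/qP; have := VJ _ g Vxy; rewrite conjgE invMg !mulgA.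
pose W x := \sum_t E (s t) x.
(* Right translation permutes the cosets, so the sum does not depend on the representatives. *)
have W_shift g x : \sum_t E (s t * g)%g x = W x.
  rewrite /W [RHS](reindex (fun t => q (s t * g)%g)) /=.
    by apply: eq_bigr => t _; rewrite Es.
  exists (fun t => q (s t * g^-1)%g) => t _.
    rewrite -[RHS]qs (qM _ (s t * g)%g) ?qs //.
    by rewrite mulgK.
  by rewrite -[RHS]qs (qM _ (s t * g^-1)%g) ?qs // mulgKV.
have cW : continuous_cochain W.
  apply/continuous_cochainP; apply: locally_constant_sum => t.
  apply: (locally_constant_map (act (s t)^-1%g)).
  exact: cons1_locally_constant.
have dW x : coboundary W x = f x *+ (p ^ e).
  have fE h : f x = act (x ord0) (E (h * x ord0)%g (tailx x)) +
      \sum_(i < r.+1) E h (face i x) *~ (-1) ^+ i.+1.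
    have := congr1 (fun F => F (consx h x)) df; rewrite [RHS]/=.
    rewrite coboundary_cons => /eqP; rewrite subr_eq0 => /eqP/(congr1 (act h^-1%g)).
    rewrite actK actD act_sum => ->; congr (_ + _).
      by rewrite /E -actM invMg mulKVg.
    by apply: eq_bigr => i _; rewrite actMz.
  rewrite -cT -sumr_const (eq_bigr _ (fun t _ => fE (s t))) big_split /=.
  rewrite -act_sum W_shift; congr (_ + _).
  rewrite exchange_big /=; apply: eq_bigr => i _.
  by rewrite mulrz_suml.
have ej : coprime (p ^ e) j by exact: coprimeXl.
have pe0 : (0 < p ^ e)%N by rewrite expn_gt0 prime_gt0.
have [c d cd _] := egcdnP j pe0.
(* The integer [c] inverts [p ^ e] modulo [j], and [j] kills [f]. *)
have fE : f = f *+ (p ^ e) *+ c.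
  apply/funext => t; rewrite -mulrnA mulnC cd (eqP ej) natmulfctE.
  by rewrite mulrnDr mulnC mulrnA fj mul0rn add0r.
rewrite fE; apply: trivial_inMn; first exact: submoduleT.
by exists W; split=> //; apply/funext => t; rewrite dW natmulfctE.
Qed.

(** Along a composition series, the coordinate of the cocycle is a coboundary by the assumption on
    F_p. Subtracting the coboundary of a lift moves the cocycle into the previous term. *)
Lemma ptorsion_trivial (A : discreteModType G) (S : set A) (f : ('I_r.+1 -> G) -> A) :
  (forall f : ('I_r.+1 -> G) -> k, f \in @is_cocycle G k r.+1 -> trivial_in setT f) ->
  finite_set S -> submodule S -> (forall a, S a -> exists e, a *+ (p ^ e) = 0) ->
  f \in @is_cocycle G A r.+1 -> (forall t, S (f t)) -> trivial_in S f.
Proof.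
move=> Fp_trivial fS sS torS.
pose R S' := forall f : ('I_r.+1 -> G) -> A,
  f \in @is_cocycle G A r.+1 -> (forall t, S' (f t)) -> trivial_in S' f.
apply: (submodule_ind p_pr Gp (R := R) fS sS torS) =>
  [y _ y0|S' a sS' S'S Sa nS'a S'pa ga PS' y zy Ey].
  have -> : y = 0 by apply/funext.
  exact/trivial_in0/submodule0.
have [coord [coord_hom coord_gen coord_in]] := extension_coord p_pr sS' nS'a S'pa ga.
have sE := submodule_extension p_pr sS' S'pa ga.
have [w [cw _ dw]] := Fp_trivial _ (is_cocycle_hom sE coord_hom Ey zy).
pose am (c : k) : A := a *+ (c : 'F_p); pose aw : ('I_r -> G) -> A := am \o w.
have caw : continuous_cochain aw by exact: continuous_cochain_map.
have Eaw x : extension S' a (aw x).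
  by apply: (submoduleMn _ sE); exact: extension_gen.
have [z [cz Sz dz]] : trivial_in S' (y - coboundary aw).
  apply: PS'; first by apply: rpredB => //; exact: is_cocycle_coboundary.
  move=> t; have [_ EB _] := sE; have Edaw := coboundary_in sE Eaw.
  apply: coord_in; first exact: EB.
  rewrite (_ : (y - coboundary aw) t = y t - coboundary aw t) // coord_hom.1 //.
  rewrite -(coboundary_hom sE coord_hom) // (_ : coord \o aw = w) ?dw ?subrr //.
  by apply/funext => x; exact: coord_gen.
exists (z + aw); split; first exact: continuous_cochainD.
  by move=> x; apply: submoduleD => //; exact/extension_sub/Sz.
by rewrite coboundaryD dz subrK.
Qed.

Lemma torsion_trivial (A : discreteModType G) (f : ('I_r.+1 -> G) -> A) :
  (forall f : ('I_r.+1 -> G) -> k, f \in @is_cocycle G k r.+1 -> trivial_in setT f) ->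
  torsion_module A -> f \in @is_cocycle G A r.+1 -> trivial_in setT f.
Proof.
move=> Fp_trivial torA zf; have [cG _ _ _] := Gp; have /asboolP[cf df] := zf.
have cK := ptws_compact (n := r.+1) cG.
have [N N0 fN] : exists2 N, (0 < N)%N & forall t, f t *+ N = 0.
  have /finite_seqP[s sE] := finite_range_locally_constant cK (iffLR (continuous_cochainP _) cf).
  have [N N0 sN] := torsion_seq s torA.
  exists N => // t; apply: sN; have : range f (f t) by exists t.
  by rewrite sE.
have zMn n : f *+ n \in @is_cocycle G A r.+1 by exact: rpredMn.
pose j := (N`_p^')%N; pose q := (N`_p)%N.
have qj : (q * j = N)%N by exact: partnC.
have q0 : (0 < q)%N by exact: part_gt0.
have j0 : (0 < j)%N by exact: part_gt0.
have cop : coprime q j by exact: coprime_partC.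
have pj : coprime p j by exact: pnat_coprime (pnat_id p_pr) (part_pnat _ _).
have [c d cd _] := egcdnP q j0.
(* The Bezout relation [c * j = d * q + 1] splits [f] into a part killed by the p-power [q] and a
   part killed by [j], which is prime to p. *)
have fE : f = f *+ (c * j) - f *+ (d * q).
  by rewrite cd gcdnC (eqP cop) mulrnDr mulr1n addrAC subrr add0r.
have tq : trivial_in setT (f *+ (d * q)).
  apply: (coprime_torsion_trivial (zMn _) pj) => t; rewrite natmulfctE.
  by rewrite -!mulrnA -mulnA qj mulnC mulrnA fN mul0rn.
have tj : trivial_in setT (f *+ (c * j)).
  have [e qe] : exists e, q = (p ^ e)%N by exists (logn p N); exact: p_part.
  (* All translates of the values are taken, so that this finite set is stable under [G] and
     generates a finite submodule. *)
  pose B := range (fun gt : G * {ptws 'I_r.+1 -> G} => act gt.1 ((f *+ (c * j)) gt.2)).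
  have cfj : continuous_cochain (f *+ (c * j)) by have /asboolP[] := zMn (c * j)%N.
  have fB : finite_set B by exact: act_finite_range cG cK (iffLR (continuous_cochainP _) cfj).
  have [|b|S [sS fS BS SN]] := @generated_submodule G A B q fB _ q0.
  - by move=> g _ [[h t] _ <-]; exists ((g * h)%g, t) => //=; rewrite actM.
  - move=> [[h t] _ <-] /=; rewrite natmulfctE.
    by rewrite -actMn -mulrnA -mulnA (mulnC j) qj mulnC mulrnA fN mul0rn act0.
  apply: (trivial_inW (S := S)) => //.
  apply: (ptorsion_trivial Fp_trivial fS sS _ (zMn _)) => [a Sa|t].
    by exists e; rewrite -qe SN.
  by apply: BS; exists (1%g, t) => //=; rewrite act1.
by rewrite fE; exact: trivial_inB.
Qed.
End Torsion.

(** * Cohomology classes and duality in terms of cocycles *)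

Section Classes.
Variables (G : topGroupType) (A : discreteModType G).

Lemma coh_classB n (f g : cocycle A n) : coh_class (f - g) = coh_class f - coh_class g.
Proof. exact: (raddfB \pi_{ideal_quot @is_coboundary G A n}%qT). Qed.

Lemma coh_class0 n : coh_class (0 : cocycle A n) = 0.
Proof. by rewrite -(subrr 0) coh_classB subrr. Qed.

Lemma coh_class_eq0 n (f : cocycle A n.+1) :
  coh_class f = 0 <-> trivial_in setT (cochain_of f).
Proof.
rewrite -coh_class0; split.
  by move/coh_class_eq; rewrite subr0 => /asboolP[h ch fh]; exists h.
by move=> [h [ch _ hf]]; apply/coh_class_eq; rewrite subr0; apply/asboolP; exists h.
Qed.

End Classes.

Lemma cohomology_trivial_above (p r : nat) (G : topGroupType) :
  prime p -> pro_p_group p G ->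
  (forall f : ('I_r.+1 -> G) -> trivial_module G 'F_p,
     f \in @is_cocycle G (trivial_module G 'F_p) r.+1 -> trivial_in setT f) ->
  forall d (A : discreteModType G) (f : ('I_(d + r).+1 -> G) -> A),
    torsion_module A -> f \in @is_cocycle G A (d + r).+1 -> trivial_in setT f.
Proof.
move=> p_pr Gp Fp_trivial; have [cG _ _ _] := Gp.
elim=> [|d IH] A f torA zf; first exact: (torsion_trivial p_pr Gp Fp_trivial torA zf).
apply: (shift_cochain_trivial (cG := cG) (zf := zf)).
by apply: IH; [exact: shift_torsion|exact: shift_cochain_cocycle].
Qed.

Lemma trivial_torsion (p : nat) (G : topGroupType) : prime p ->
  torsion_module (trivial_module G 'F_p).
Proof.
move=> p_pr c; exists p; first exact: prime_gt0.
exact: (mulrn_pchar (pchar_Fp p_pr)).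
Qed.

Section GPD.
Variables (p m : nat) (G : topGroupType).
Hypothesis p_pr : prime p.
Notation k := (trivial_module G 'F_p).
Variable phi : {additive Fp_cohomology p G m.+1 -> 'F_p}.
Hypothesis phi_inj : injective phi.

(** [phi] read on raw cochains; the value [0] away from cocycles is a default. *)
Definition top_functional (x : ('I_m.+1 -> G) -> k) : 'F_p :=
  if pselect (x \in @is_cocycle G k m.+1) is left zx
  then phi (coh_class (Cocycle zx)) else 0.

Lemma top_functionalE (c : cocycle k m.+1) :
  top_functional (cochain_of c) = phi (coh_class c).
Proof.
rewrite /top_functional; case: pselect => [zc|]; last by case; exact: cocycleP.
by congr (phi (coh_class _)); exact: val_inj.
Qed.

Lemma top_functionalB x y : x \in @is_cocycle G k m.+1 -> y \in @is_cocycle G k m.+1 ->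
  top_functional (x - y) = top_functional x - top_functional y.
Proof.
move=> zx zy; have := top_functionalE (Cocycle zx - Cocycle zy).
rewrite coh_classB raddfB -!top_functionalE => <-.
by [].
Qed.

Lemma top_functional_eq0 x : x \in @is_cocycle G k m.+1 ->
  top_functional x = 0 <-> trivial_in setT x.
Proof.
move=> zx; rewrite (top_functionalE (Cocycle zx)); split.
  rewrite -[RHS](raddf0 phi) => /phi_inj; exact: (iffLR (coh_class_eq0 _)).
by move=> /(iffRL (coh_class_eq0 (Cocycle zx))) ->; rewrite raddf0.
Qed.

(** The homomorphism [f] is a cocycle of degree 1 whose class is orthogonal to everything, hence
    zero. With trivial action a coboundary of degree 1 vanishes, so [f] itself is zero. *)
Lemma top_functional_nondegenerate (f : G -> 'F_p) (le1 : (1 <= m.+1)%N) :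
  nondegenerate_pairing (fun (x : Fp_cohomology p G 1) (y : Fp_cohomology p G (m.+1 - 1)) =>
    phi (cup (subnKC le1) x y)) ->
  locally_constant f -> (forall g h, f (g * h)%g = f g + f h) ->
  (forall w, w \in @is_cocycle G k m ->
     top_functional (fun x => f (x ord0) * w (tailx x)) = 0) ->
  forall g, f g = 0.
Proof.
move=> [inj1 _] lf fM fw g; pose F (t : 'I_1 -> G) : k := f (t ord0).
have zF : F \in @is_cocycle G k 1.
  apply/asboolP; split.
    apply/continuous_cochainP => x.
    exact: (@coord_continuous G 1 ord0 x _ (lf (x ord0))).
  apply/funext => t; rewrite [t]consx_eta; move: (t ord0) (tailx t) => h x.
  rewrite coboundary_cons big_ord1 /= expr1 mulrN1z /F !consx0 fM.
  by rewrite [f h + _]addrC addrK; exact: subrr.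
(* The degree is a variable [j], so that [m.+1 - 1] can be identified with [m]. *)
have cup0 j (e : (1 + j)%N = m.+1) (y : cohomology k j) :
    phi (cup e (coh_class (Cocycle zF)) y) = phi (cup e 0 y).
  have jm : j = m by case: e.
  subst j; rewrite -[y]coh_reprK -coh_class0 !cup_class.
  have -> : coh_class (cocycle_cup e 0 (coh_repr y)) = 0.
    rewrite -coh_class0; apply/coh_class_eq; rewrite subr0.
    by apply: coboundary_cupl; exact: rpred0.
  rewrite raddf0 -top_functionalE -[RHS](fw _ (cocycleP (coh_repr y))).
  congr top_functional; apply/funext => t; rewrite /= /cochain_cup /F.
  congr (f (t _) * _); first exact: val_inj.
  by congr (coh_repr y _); apply/funext => i; congr (t _); exact: val_inj.
have : coh_class (Cocycle zF) = 0 by apply: inj1; apply/funext => y; exact: cup0.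
move=> /coh_class_eq0[z [_ _ dz]].
have : F (fun=> g) = 0.
  rewrite -[F]dz /coboundary big_ord1 expr1 mulrN1z.
  rewrite (_ : face _ _ = (fun i : 'I_0 => g)); last by apply/funext => -[].
  exact: subrr.
exact.
Qed.
End GPD.

Theorem corollary5 (p n : nat) (G : topGroupType) (p_prime : prime p)
  (n_gt0 : (0 < n)%N) (G_gpd : GPD_group p n G) : cd G = Some n.
Proof.
case: n n_gt0 G_gpd => [//|m] _ [Gp infG [phi phi_bij nondeg]].
have phi_inj := bij_inj phi_bij.
have Fp_trivial : forall f : ('I_m.+2 -> G) -> trivial_module G 'F_p,
    f \in @is_cocycle G (trivial_module G 'F_p) m.+2 -> trivial_in setT f.
  apply: (trivial_Fp_cocycle p_prime Gp infG) => M S x.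
  apply: (killed_by_homs_trivial p_prime Gp (Phi := top_functional phi)).
  - exact: top_functionalB.
  - exact: top_functional_eq0.
  - by move=> f; exact: (top_functional_nondegenerate (nondeg 1%N isT)).
have cd_le_n : cd_le G m.+1.
  move=> A torA q mq x; rewrite -[x]coh_reprK.
  have [d qE] : exists d, q = (d + m.+1).+1 by exists (q - m.+2)%N; rewrite -addnS subnK.
  subst q; apply/coh_class_eq0.
  by apply: (cohomology_trivial_above p_prime Gp Fp_trivial torA); exact: cocycleP.
have cd_ge_n j : cd_le G j -> (m.+1 <= j)%N.
  move=> cdj; rewrite leqNgt; apply/negP => jm.
  (* The class [psi 1] in degree [m.+1] is nonzero because [phi] sends it to 1. *)
  have [psi _ phiK] := phi_bij.
  have := phiK 1; rewrite (cdj _ (trivial_torsion p_prime) _ jm (psi 1)) raddf0.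
  by move/eqP; rewrite eq_sym oner_eq0.
rewrite /cd; case: pselect => [h|]; last by case; exists m.+1; apply/asboolP.
case: ex_minnP => j /asboolP/cd_ge_n mj minj; congr Some; apply/eqP.
by rewrite eqn_leq mj andbT; apply: minj; apply/asboolP.
Qed.
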